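(* Assume the change-point regression model $Y_i=\mu(i/n)+\sigma\varepsilon_i$, $i=0,\dots,n-1$, with $\varepsilon_0,\dots,\varepsilon_{n-1}$ independent standard normal and $\sigma>0$, and let $B_{\nu,\epsilon,L}$ be the class of step functions $\mu$ on $[0,1)$ with $\lambda_\mu\ge\nu$ and, if $K_\mu\ge1$, $\epsilon\le\Delta_\mu\le\tilde\Delta_\mu\le L$ (where $0<\nu<1/2$ and $0<\epsilon<L<\infty$). (i) There is a positive constant $C$, such that $$\inf_{\hat\mu_n}\sup_{\mu\in B_{\nu,\epsilon,L}}\mathbf{E}\left[\|\hat\mu_n-\mu\|_{L^p}\right]\ge C\left(\frac{\sigma^2}{n}\right)^{\min\{1/2,1/p\}},$$ for any $\sigma>0$, $0<\nu<1/2$, $0<\epsilon<1<L<\infty$, and $1\le p<\infty$. (ii) If $an^{-\gamma}\le\nu:=\nu_n\le bn^{-\gamma}$ with constants $a,b>0$, $0<\gamma<1$, then there is a positive constant $C$, such that $$\inf_{\hat\mu_n}\sup_{\mu\in B_{\nu_n,\epsilon,L}}\mathbf{E}\left[\|\hat\mu_n-\mu\|_{L^p}\right]\ge C\left(\frac{\sigma^2}{bn^{1-\gamma}}\right)^{\min\{1/2,1/p\}},$$ for any $a,b,\sigma>0$, $0<\gamma<1$, $0<\epsilon<1<L<\infty$, and $1\le p<\infty$.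
   Context: Step functions: $\mu=\sum_{k=0}^{K}c_k\mathbf{1}_{[\tau_k,\tau_{k+1})}$ with $0=\tau_0<\tau_1<\dots<\tau_K<\tau_{K+1}=1$ and $c_k\ne c_{k+1}$ for $k=0,\dots,K-1$; $K=K_\mu$ is the number of change-points. $\lambda_\mu=\min_{0\le k\le K}|\tau_{k+1}-\tau_k|$ is the smallest segment length; if $K_\mu\ge1$, $\Delta_\mu=\min_{1\le k\le K}|c_k-c_{k-1}|$ and $\tilde\Delta_\mu=\max_{1\le k\le K}|c_k-c_{k-1}|$ are the smallest and largest jump sizes. The infima are over all estimators $\hat\mu_n$ based on the $n$ observations $Y_0,\dots,Y_{n-1}$, and $\|\cdot\|_{L^p}$ is the norm of $L^p([0,1))$.
   Formalization: One constant C for all parameters is impossible, so in (i) C may depend on ν (not on n, σ, ε, L, p), and in (ii) C may depend on b, σ, γ, ε, L (not on a, p, n or the sequence ν_n). *)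

(* Defs.v *)
From HB Require Import structures.
From mathcomp Require Import all_boot all_order all_algebra.
From mathcomp Require Import all_classical all_reals all_analysis.

Set Implicit Arguments.
Unset Strict Implicit.
Unset Printing Implicit Defensive.

Import Order.TTheory GRing.Theory Num.Theory.
Import numFieldNormedType.Exports.

Local Open Scope classical_set_scope.
Local Open Scope ring_scope.

(* The values of [cpt] beyond [nchange.+1] and of [level] beyond [nchange] are
   irrelevant. *)
Record stepFun (R : realType) := StepFun {
  nchange : nat;
  cpt : nat -> R;
  level : nat -> R;
  cpt_first : cpt 0 = 0;
  cpt_last : cpt nchange.+1 = 1;
  cpt_lt : forall k, (k <= nchange)%N -> cpt k < cpt k.+1;
  level_neq : forall k, (k < nchange)%N -> level k != level k.+1 }.

Definition step_eval (R : realType) (s : stepFun R) (x : R) : R :=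
  \sum_(k < (nchange s).+1) level s k * \1_(`[cpt s k, cpt s k.+1[) x.

Coercion step_eval : stepFun >-> Funclass.

(* In the three iterated minima/maxima the default value is the first term, so
   that it has no effect (for the jumps, as soon as [nchange s > 0]). *)
Definition min_segment (R : realType) (s : stepFun R) : R :=
  \big[Num.min/`|cpt s 1 - cpt s 0|]_(0 <= k < (nchange s).+1)
    `|cpt s k.+1 - cpt s k|.

Definition min_jump (R : realType) (s : stepFun R) : R :=
  \big[Num.min/`|level s 1 - level s 0|]_(1 <= k < (nchange s).+1)
    `|level s k - level s k.-1|.

Definition max_jump (R : realType) (s : stepFun R) : R :=
  \big[Num.max/`|level s 1 - level s 0|]_(1 <= k < (nchange s).+1)
    `|level s k - level s k.-1|.

Definition step_class (R : realType) (nu epsilon L : R) : set (stepFun R) :=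
  [set s | nu <= min_segment s /\
           ((0 < nchange s)%N ->
            epsilon <= min_jump s /\ min_jump s <= max_jump s /\
            max_jump s <= L)].

Definition mutually_independent d (Omega : measurableType d) (R : realType)
    (P : probability Omega R) n (X : 'I_n -> {RV P >-> R}) : Prop :=
  forall (J : {set 'I_n}) (A : 'I_n -> set R),
    (forall i, measurable (A i)) ->
    P (\bigcap_(i in [set` J]) (X i @^-1` A i)) =
    (\prod_(i in J) P (X i @^-1` A i))%E.

Definition standard_normal d (Omega : measurableType d) (R : realType)
    (P : probability Omega R) (X : {RV P >-> R}) : Prop :=
  forall A : set R, measurable A -> distribution P X A = normal_prob 0 1 A.

Definition gaussian_noise d (Omega : measurableType d) (R : realType)
    (P : probability Omega R) n (eps : 'I_n -> {RV P >-> R}) : Prop :=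
  mutually_independent eps /\ forall i, standard_normal (eps i).

Definition observations d (Omega : measurableType d) (R : realType)
    (P : probability Omega R) n (eps : 'I_n -> {RV P >-> R}) (sigma : R)
    (mu : R -> R) (w : Omega) : n.-tuple R :=
  [tuple mu (i%:R / n%:R) + sigma * eps i w | i < n].

(* Joint measurability makes every estimate a measurable function and the loss
   a measurable function of the data.  Estimates of infinite norm are allowed:
   their loss is +oo. *)
Definition estimator (R : realType) n : set (n.-tuple R -> R -> R) :=
  [set muhat | measurable_fun [set: n.-tuple R * R]
                 (fun z => muhat z.1 z.2)].

Definition Lp_norm01 (R : realType) (p : R) (f : R -> R) : \bar R :=
  ('N[mrestr (@lebesgue_measure R) (measurable_itv `[0%R, 1%R[)]_p%:E
     [EFin \o f])%E.

Definition risk d (Omega : measurableType d) (R : realType)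
    (P : probability Omega R) n (eps : 'I_n -> {RV P >-> R}) (sigma p : R)
    (muhat : n.-tuple R -> R -> R) (mu : R -> R) : \bar R :=
  (\int[P]_w
     Lp_norm01 p (fun x => muhat (observations eps sigma mu w) x - mu x)%R)%E.

Definition minimax_risk d (Omega : measurableType d) (R : realType)
    (P : probability Omega R) n (eps : 'I_n -> {RV P >-> R}) (sigma p : R)
    (B : set (stepFun R)) : \bar R :=
  ereal_inf [set ereal_sup [set risk eps sigma p muhat mu | mu in B]
            | muhat in @estimator R n].

(* Main.v *)
Require Import Defs.
From HB Require Import structures.
From mathcomp Require Import all_boot all_order all_algebra.
From mathcomp Require Import all_classical all_reals all_analysis.
From mathcomp Require Import measurable_realfun ring lra.

Set Implicit Arguments.
Unset Strict Implicit.
Unset Printing Implicit Defensive.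

Import Order.TTheory GRing.Theory Num.Theory.
Import numFieldNormedType.Exports.
Import HBNNSimple.

Local Open Scope classical_set_scope.
Local Open Scope ring_scope.

(* Both bounds are instances of Assouad's lemma. Take functions
   s_t = g + eta * sum_k t_k 1_{I_k}, indexed by t in {0,1}^m, where the I_k are
   disjoint, have the same length delta, and each contain so few design points
   that eta^2 * #{i | i/n in I_k} <= 4 K sigma^2. The data cannot decide t_k:
   for two means at squared distance at most 4 K sigma^2 the Gaussian likelihood
   ratio gives E[G] + E'[G'] >= h e^(-K) / 2 as soon as G + G' >= h. Summing
   over k and averaging over t bounds the L^1 loss on the union of the I_k, whose
   measure is m delta, and Hoelder's inequality turns this into the lower bound
   e^(-K) / 4 * eta * (m delta)^(1/p) for the L^p loss.
   Three families are used: constants 0 and eta = sigma / sqrt n on the whole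
   of [0,1); m blocks in which a level is perturbed by eta; m blocks in which a
   jump of size 1 is moved by delta, so that eta = 1. In part (i) the second one
   is not needed and m = 1. In part (ii), with w = b n^(-gamma) >= nu_n, the
   number m of blocks is of order 1 / w; moreover eta^2 is of order
   r = sigma^2 / (n w) when p <= 2, and delta is of order sigma^2 / n when
   p > 2. If w > 1/4 then n is bounded and the constants suffice. *)

(** * Measures given by a density *)

Section density.
Context d (T : measurableType d) (R : realType).
Variables (mu : {measure set T -> \bar R}) (w : T -> R).
Hypotheses (mw : measurable_fun setT w) (w0 : forall x, 0 <= w x).
Local Open Scope ereal_scope.

(** The two proofs are arguments of the term, so that the measure structure declared below can be
    inferred from it. *)
Definition density of measurable_fun setT w & (forall x, 0 <= w x)%R :
  set T -> \bar R := fun A => \int[mu]_(x in A) (w x)%:E.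

Local Notation nu := (density mw w0).

Let density0 : nu set0 = 0.
Proof. by rewrite /density integral_set0. Qed.

Let density_ge0 A : 0 <= nu A.
Proof. by apply: integral_ge0 => x _; rewrite lee_fin. Qed.

Let density_semi_sigma_additive : semi_sigma_additive nu.
Proof.
move=> F mF tF mUF; rewrite /density ge0_integral_bigcup//.
- by apply: is_cvg_ereal_nneg_natsum_cond => n _ _; exact: density_ge0.
- by apply/measurable_EFinP; exact: (measurable_funS measurableT).
- by move=> x _; rewrite lee_fin.
Qed.

HB.instance Definition _ := isMeasure.Build _ _ _ nu
  density0 density_ge0 density_semi_sigma_additive.

(** Both sides are limits, by monotone convergence, along simple functions increasing to [f]; for a
    simple function the identity is checked on each level set. *)
Lemma ge0_integral_density (f : T -> \bar R) :
  measurable_fun setT f -> (forall x, 0 <= f x) ->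
  \int[nu]_x f x = \int[mu]_x (f x * (w x)%:E).
Proof.
move=> mf f0.
pose f_ := nnsfun_approx measurableT mf.
have fE x : (f_ n x)%:E @[n --> \oo] --> f x by exact: cvg_nnsfun_approx.
have nd x : {homo (fun n => f_ n x) : m n / (m <= n)%N >-> (m <= n)%R}.
  by move=> m n mn; exact/lefP/nd_nnsfun_approx.
transitivity (limn (fun n => \int[nu]_x (f_ n x)%:E)).
  rewrite -monotone_convergence//.
  - by apply: eq_integral => x _; apply/esym/cvg_lim.
  - by move=> n; exact/measurable_EFinP.
  - by move=> n x _; rewrite lee_fin.
  - by move=> x _ m n mn; rewrite lee_fin nd.
transitivity (limn (fun n => \int[mu]_x ((f_ n x)%:E * (w x)%:E))); last first.
  rewrite -monotone_convergence//.
  - by apply: eq_integral => x _; apply/cvg_lim => //; exact: cvgeZr.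
  - move=> n; rewrite -/(measurable_fun _ _).
    by apply: emeasurable_funM => //; exact/measurable_EFinP.
  - by move=> n x _; rewrite mule_ge0// lee_fin.
  - by move=> x _ m n mn; rewrite lee_wpmul2r// lee_fin// nd.
congr (limn _); apply/funext => n.
rewrite integralT_nnsfun sintegralE.
transitivity (\int[mu]_x \sum_(r \in range (f_ n))
    (r * \1_(f_ n @^-1` [set r]) x * w x)%:E).
  rewrite ge0_integral_fsum//=.
  - apply: eq_fsbigr => r /[!inE] -[x _ rE].
    have r0 : (0 <= r)%R by rewrite -rE.
    under [RHS]eq_integral do rewrite -mulrA EFinM.
    rewrite ge0_integralZl_EFin//.
    + congr (_ * _); rewrite /density integral_mkcond.
      apply: eq_integral => y _; rewrite patchE indicE.
      by case: ifP => _; rewrite ?mul1r ?mul0r.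
    + by move=> y _; rewrite lee_fin mulr_ge0.
    + by apply/measurable_EFinP; exact: measurable_funM.
  - move=> r; apply/measurable_EFinP; apply: measurable_funM => //.
    exact: measurable_funM.
  - move=> r x _; rewrite lee_fin mulr_ge0// -lee_fin.
    exact: nnfun_muleindic_ge0.
apply: eq_integral => x _.
rewrite fsumEFin// -EFinM [in RHS](fimfunE (f_ n)); congr EFin.
rewrite fsbig_finite// [in RHS]fsbig_finite// mulr_suml.
by [].
Qed.

End density.

(** * Independent random variables *)

Section independence.
Context d (Omega : measurableType d) (R : realType) (P : probability Omega R).
Variables (n : nat) (X : 'I_n -> {RV P >-> R}).
Hypothesis indepX : mutually_independent X.

Let integral_prod_indic (A : 'I_n -> set R) : (forall i, measurable (A i)) ->
  (\int[P]_w (\prod_i \1_(A i) (X i w))%:E = \prod_i P (X i @^-1` A i))%E.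
Proof.
move=> mA; have := indepX [set: 'I_n]%SET mA.
under eq_bigl do rewrite inE.
move=> <-; rewrite -[in RHS](setIT (\bigcap_(i in _) _)) -integral_indic//.
  apply: eq_integral => w _; congr EFin; rewrite indicE.
  have [wA|wA] := pselect
      ((\bigcap_(i in [set` [set: 'I_n]%SET]) (X i @^-1` A i)) w).
    rewrite mem_set// big1// => i _.
    by rewrite indicE mem_set//; apply: wA => /=; rewrite inE.
  rewrite memNset//; move/existsNP : wA => [i /not_implyP[_ wA]].
  by rewrite (bigD1 i)//= indicE memNset ?mul0r.
apply: fin_bigcap_measurable => // i _.
by rewrite -[_ @^-1` _]setTI; exact: measurable_funPT.
Qed.

(** Independence is the case of indicator factors. General factors are introduced one at a time: the
    product of the other factors is taken as a density, and under it the law of [X k0] is a multiple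
    of its law under [P]. *)
Lemma independent_integral_prod (g : 'I_n -> R -> R) (e : 'I_n -> R) :
  (forall i, measurable_fun setT (g i)) -> (forall i x, 0 <= g i x) ->
  (forall i, \int[P]_w (g i (X i w))%:E = (e i)%:E)%E ->
  (\int[P]_w (\prod_i g i (X i w))%:E = (\prod_i e i)%:E)%E.
Proof.
(* Factors of index at least [k] are still indicators: [k = 0] is independence, and [k = n] is the
   claim. *)
suff H (k : nat) : forall (g : 'I_n -> R -> R) (e : 'I_n -> R),
    (forall i, measurable_fun setT (g i)) ->
    (forall i x, 0 <= g i x) ->
    (forall i, \int[P]_w (g i (X i w))%:E = (e i)%:E)%E ->
    (forall i : 'I_n, (k <= i)%N -> exists A, measurable A /\ g i = \1_A) ->
    (\int[P]_w (\prod_i g i (X i w))%:E = (\prod_i e i)%:E)%E.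
  by move=> mg g0 ge; apply: (H n) => // i; rewrite leqNgt ltn_ord.
elim: k => [|k IH] {}g {}e mg g0 ge gA.
  have [A AP] := choice (fun i => gA i isT).
  have mA i : measurable (A i) by have [] := AP i.
  transitivity (\int[P]_w (\prod_i \1_(A i) (X i w))%:E)%E.
    apply: eq_integral => w _; congr EFin.
    by apply: eq_bigr => i _; have [_ ->] := AP i.
  rewrite integral_prod_indic// (big_morph EFin EFinM erefl).
  apply: eq_bigr => i _; rewrite -ge; have [_ ->] := AP i.
  rewrite -[in LHS](setIT (_ @^-1` _)) -integral_indic//.
  by rewrite -[_ @^-1` _]setTI; exact: measurable_funPT.
have [nk|kn] := leqP n k.
  by apply: IH => // i ki; move: (leq_trans nk ki); rewrite leqNgt ltn_ord.
pose k0 := Ordinal kn.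
pose w u := \prod_(i | i != k0) g i (X i u).
have mw : measurable_fun setT w.
  rewrite /w; under eq_fun do rewrite -big_filter.
  apply: measurable_prod => i _.
  exact: (measurableT_comp (mg i)).
have w0 u : 0 <= w u by apply: prodr_ge0.
pose c := \prod_(i | i != k0) e i.
have e0 i : 0 <= e i.
  by rewrite -lee_fin -ge integral_ge0// => x _; rewrite lee_fin.
have c0 : 0 <= c by apply: prodr_ge0.
(* The induction hypothesis, applied with the indicator of [A] in place of [g k0], identifies the
   law of [X k0] under the density [w]. *)
have key A : measurable A ->
    (\int[P]_(u in X k0 @^-1` A) (w u)%:E = c%:E * P (X k0 @^-1` A))%E.
  move=> mA.
  pose g' i := if i == k0 then \1_A else g i : R -> R.
  pose e' i := if i == k0 then fine (P (X k0 @^-1` A)) else e i.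
  have mXA : measurable (X k0 @^-1` A).
    by rewrite -[_ @^-1` _]setTI; exact: measurable_funPT.
  have e'E : \prod_i e' i = c * fine (P (X k0 @^-1` A)).
    rewrite (bigD1 k0)//= {1}/e' eqxx mulrC; congr (_ * _).
    by apply: eq_bigr => i /negbTE ik; rewrite /e' ik.
  have := IH g' e'; rewrite e'E EFinM fineK ?fin_num_measure// => <-.
  - rewrite integral_mkcond; apply: eq_integral => u _.
    rewrite (bigD1 k0)//= {1}/g' eqxx.
    rewrite (eq_bigr (fun i => g i (X i u))) => [|i /negbTE ik];
      last by rewrite /g' ik.
    rewrite patchE indicE.
    have [uA|uA] := boolP (u \in _).
      by rewrite mem_set ?mul1r//; rewrite inE in uA.
    by rewrite memNset ?mul0r//; rewrite notin_setE in uA.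
  - by move=> i; rewrite /g'; case: ifP => // _; exact: measurable_indic.
  - by move=> i x; rewrite /g'; case: ifP.
  - move=> i; rewrite /g' /e'; case: ifP => // /eqP ->.
    rewrite fineK ?fin_num_measure// -[in RHS](setIT (_ @^-1` _)).
    by rewrite -integral_indic.
  - move=> i ki; rewrite /g'; case: ifPn => [_|ik]; first by exists A.
    apply: gA; rewrite ltn_neqAle ki andbT.
    by apply: contra ik => /eqP ik; apply/eqP/val_inj.
transitivity (\int[density P mw w0]_u (g k0 (X k0 u))%:E)%E.
  rewrite ge0_integral_density//.
  - by apply: eq_integral => u _; rewrite (bigD1 k0)//= EFinM.
  - by apply/measurable_EFinP; exact: (measurableT_comp (mg k0)).
  - by move=> u; rewrite lee_fin.
have mgk : measurable_fun setT (fun x => (g k0 x)%:E).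
  exact/measurable_EFinP.
transitivity (\int[pushforward (density P mw w0) (X k0)]_x (g k0 x)%:E)%E.
  by rewrite ge0_integral_pushforward// => x _; rewrite lee_fin.
rewrite (eq_measure_integral
  (mscale (NngNum c0) (distribution P (X k0)))); last first.
  by move=> A mA _; exact: key.
rewrite ge0_integral_mscale//; last by move=> x _; rewrite lee_fin.
rewrite ge0_integral_distribution//; last by move=> x; rewrite lee_fin.
by rewrite /= ge -EFinM [in RHS](bigD1 k0)//= mulrC.
Qed.

End independence.

(** * Change of measure for Gaussian noise *)

Section gaussian_shift.
Context (R : realType).
Local Notation leb := (@lebesgue_measure R).

(** The pushforward by a translation gives each half-open interval its length, which characterises
    Lebesgue measure. *)
Lemma lebesgue_measure_shift (b : R) (A : set R) : measurable A ->
  leb ((fun x => x + b) @^-1` A) = leb A.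
Proof.
pose f : measurableTypeR R -> measurableTypeR R := fun x => (x + b)%R.
have mf : measurable_fun [set: measurableTypeR R] f.
  exact: measurable_funD.
pose mmf := isMeasurableFun.Build _ _ _ _ _ mf.
pose F : {mfun measurableTypeR R >-> measurableTypeR R} := HB.pack f mmf.
move=> mA; apply/esym.
rewrite (@lebesgue_measure_unique _ (pushforward leb F))// => _ [[x y] _ <-].
rewrite /pushforward.
rewrite [X in _ = leb X](_ : _ = `]x - b, y - b]%classic); last first.
  by apply/seteqP; split=> z; rewrite /= !in_itv/= ltrBlDr lerBrDr.
by rewrite !lebesgue_measure_itv/= !lte_fin ltrD2r -!EFinB opprB addrA subrK.
Qed.

Lemma ge0_integral_shift (b : R) (f : R -> \bar R) :
  measurable_fun setT f -> (forall x, 0 <= f x)%E ->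
  (\int[leb]_x f (x + b)%R = \int[leb]_x f x)%E.
Proof.
move=> mf f0.
pose s : measurableTypeR R -> measurableTypeR R := fun x => (x + b)%R.
have ms : measurable_fun [set: measurableTypeR R] s.
  exact: measurable_funD.
rewrite -[LHS](@ge0_integral_pushforward _ _ _ _ _ s ms leb setT f)//.
by apply: eq_measure_integral => A mA _; exact: lebesgue_measure_shift.
Qed.

(** Completing the square, b x - b^2/2 - x^2/2 = -(x - b)^2/2: the exponential factor turns the
    standard normal density into the one centred at [b], and a translation brings it back. *)
Lemma standard_normal_tilt d (Omega : measurableType d)
    (P : probability Omega R) (X : {RV P >-> R}) (b : R) (A : set R) :
  standard_normal X -> measurable A ->
  (\int[P]_w (expR (b * X w - b ^+ 2 / 2) * \1_A (X w))%:E =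
   P [set w | A (X w + b)%R])%E.
Proof.
move=> NX mA.
pose z (x : R) := expR (b * x - b ^+ 2 / 2) * \1_A x.
have mz : measurable_fun setT z.
  apply: measurable_funM; last exact: measurable_indic.
  apply: measurableT_comp => //.
  apply: (@measurable_funB _ _ _ _ (fun x => b * x)) => //.
  exact: measurable_funM.
have z0 x : 0 <= z x by rewrite mulr_ge0// expR_ge0.
pose Y : Omega -> measurableTypeR R := X.
have mX : measurable_fun setT X by [].
have mY : measurable_fun setT Y by exact: mX.
have mz' : measurable_fun [set: measurableTypeR R] (EFin \o z).
  exact/measurable_EFinP.
have z0' (x : measurableTypeR R) : (0 <= (z x)%:E)%E by rewrite lee_fin.
rewrite -[LHS](@ge0_integral_pushforward _ _ _ _ _ Y mY P setT (EFin \o z))//;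
  last by move=> x _; exact: z0'.
have mphi := @measurable_normal_pdf R 0 1.
have phi0 := @normal_pdf_ge0 R 0 1.
rewrite (eq_measure_integral (density leb mphi phi0)); last first.
  by move=> B mB _; rewrite [LHS]NX.
rewrite ge0_integral_density//.
pose f (x : measurableTypeR R) := (\1_A x * normal_pdf 0 1 (x - b))%:E.
rewrite (eq_integral f); last first.
  move=> x _; rewrite /f /z /= -EFinM; congr EFin.
  rewrite normal_pdfE ?oner_eq0// mulrC mulrA.
  rewrite [RHS]mulrC; congr (_ * _).
  rewrite /normal_fun mulrAC -mulrA -expRD; congr (_ * expR _).
  by field.
rewrite -(ge0_integral_shift b); last 2 first.
- apply/measurable_EFinP; apply: measurable_funM; first exact: measurable_indic.
  by apply: measurableT_comp => //; exact: measurable_funB.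
- by move=> x; rewrite lee_fin mulr_ge0.
have mAb : measurable ((fun x : R => x + b) @^-1` A).
  rewrite -[_ @^-1` _]setTI; apply: measurable_funD => //.
transitivity (normal_prob 0 1 ((fun x : R => x + b) @^-1` A)).
  rewrite /normal_prob [RHS]integral_mkcond; apply: eq_integral => x _.
  rewrite /f addrK patchE indicE.
  by rewrite /in_mem /= /in_set/=; case: asboolP; rewrite ?mul1r ?mul0r.
by rewrite -NX.
Qed.

End gaussian_shift.

(** * Laws on tuples *)

Section tuple_law.
Context (R : realType) (n : nat).

Definition box (A : 'I_n -> set R) : set (n.-tuple R) :=
  [set t | forall i, A i (tnth t i)].

Lemma boxE (A : 'I_n -> set R) :
  box A = \bigcap_(i in [set` [set: 'I_n]%SET]) ((@tnth _ R ^~ i) @^-1` A i).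
Proof.
apply/seteqP; split => t /= tA i; first by move=> _; exact: tA.
by apply: tA; rewrite /= inE.
Qed.

Lemma measurable_box (A : 'I_n -> set R) :
  (forall i, measurable (A i)) -> measurable (box A).
Proof.
move=> mA; rewrite boxE; apply: fin_bigcap_measurable => // i _.
by rewrite -[_ @^-1` _]setTI; exact: measurable_tnth.
Qed.

(** Measurable boxes are stable under intersection and generate the sigma-algebra of tuples, so two
    measures that agree on them are equal. *)
Lemma tuple_measure_unique (m1 m2 : {measure set (n.-tuple R) -> \bar R}) :
  (m1 setT < +oo)%E ->
  (forall A, (forall i, measurable (A i)) -> m1 (box A) = m2 (box A)) ->
  forall B, measurable B -> m1 B = m2 B.
Proof.
move=> m1oo m12 B mB.
pose G := [set B | exists2 A, (forall i, measurable (A i)) & B = box A].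
apply: (@g_sigma_algebra_measure_unique _ _ _ G _ (fun=> setT)) => //.
- by move=> _ [A mA ->]; exact: measurable_box.
- by move=> _; exists (fun=> setT) => //; apply/seteqP; split.
- by rewrite bigcup_const//; exists 0%N.
- move=> _ _ [A1 mA1 ->] [A2 mA2 ->]; exists (fun i => A1 i `&` A2 i).
    by move=> i; exact: measurableI.
  apply/seteqP; split => t /=.
    by move=> [t1 t2] i; split.
  by move=> tA; split => i; have [] := tA i.
- by move=> _ [A mA ->]; exact: m12.
(* The generators are preimages under one coordinate, that is, boxes whose other sides are
   [setT]. *)
- move: B mB; apply: smallest_sub; first exact: smallest_sigma_algebra.
  move=> X; rewrite -bigcup_seq/= => -[i _ [C mC <-]].
  apply: sub_sigma_algebra; exists (fun j => if j == i then C else setT).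
    by move=> j; case: ifP.
  apply/seteqP; split => t /=.
    by move=> [_ tC] j; case: eqP => [->|].
  by move=> /(_ i); rewrite eqxx; split.
Qed.

End tuple_law.

Lemma eq_ge0_integral_comp d1 (T1 : measurableType d1) d2 (T2 : measurableType d2)
    d (T : measurableType d) (R : realType) (m1 : {measure set T1 -> \bar R})
    (m2 : {measure set T2 -> \bar R}) (f1 : T1 -> T) (f2 : T2 -> T)
    (F : T -> \bar R) :
  measurable_fun setT f1 -> measurable_fun setT f2 ->
  measurable_fun setT F -> (forall t, 0 <= F t)%E ->
  (forall B, measurable B -> m1 (f1 @^-1` B) = m2 (f2 @^-1` B)) ->
  (\int[m1]_x F (f1 x) = \int[m2]_x F (f2 x))%E.
Proof.
move=> mf1 mf2 mF F0 m12.
rewrite -[LHS](@ge0_integral_pushforward _ _ _ _ _ _ mf1 m1 setT F)//.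
rewrite -[RHS](@ge0_integral_pushforward _ _ _ _ _ _ mf2 m2 setT F)//.
by apply: eq_measure_integral => B mB _; exact: m12.
Qed.

Section tilted_noise.
Context d (Omega : measurableType d) (R : realType) (P : probability Omega R).
Variables (n : nat) (eps : 'I_n -> {RV P >-> R}).
Hypothesis Heps : gaussian_noise eps.

(** The Cameron-Martin density: the likelihood ratio of N(b, Id) against N(0, Id), evaluated at the
    noise vector. *)
Definition likelihood (b : 'I_n -> R) (w : Omega) : R :=
  \prod_i expR (b i * eps i w - b i ^+ 2 / 2).

Lemma likelihood_ge0 b w : 0 <= likelihood b w.
Proof. by apply: prodr_ge0 => i _; exact: expR_ge0. Qed.

Lemma measurable_likelihood b : measurable_fun setT (likelihood b).
Proof.
apply: measurable_prod => i _; apply: measurableT_comp => //.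
apply: (@measurable_funB _ _ _ _ (fun w => b i * eps i w)) => //.
exact: measurable_funM.
Qed.

Lemma measurable_shifted_noise (b : 'I_n -> R) :
  measurable_fun [set: Omega]
    (fun w => [tuple eps i w + b i | i < n] : n.-tuple R).
Proof.
apply/measurable_fun_tnthP => i; rewrite /comp /=.
under eq_fun do rewrite tnth_mktuple.
exact: measurable_funD.
Qed.

(** Both sides factor over the coordinates by independence, and the one-dimensional tilt matches the
    factors. The [+ 0] makes both vectors instances of the same shift map. *)
Let shifted_noise_box (b : 'I_n -> R) (A : 'I_n -> set R) :
  (forall i, measurable (A i)) ->
  (P [set w | box A [tuple (eps i w + b i)%R | i < n]] =
   \int[P]_(w in [set w | box A [tuple (eps i w + 0)%R | i < n]])
     (likelihood b w)%:E)%E.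
Proof.
move=> mA; have [indep norm] := Heps.
have mAb i : measurable ((fun x : R => x + b i) @^-1` A i).
  by rewrite -[_ @^-1` _]setTI; apply: measurable_funD.
have mP i : measurable (eps i @^-1` ((fun x : R => x + b i) @^-1` A i)).
  by rewrite -[_ @^-1` _]setTI; exact: measurable_funPT.
pose g i x := expR (b i * x - b i ^+ 2 / 2) * \1_(A i) x.
pose e i := fine (P (eps i @^-1` ((fun x : R => x + b i) @^-1` A i))).
have eE i : (\int[P]_w (g i (eps i w))%:E = (e i)%:E)%E.
  by rewrite standard_normal_tilt// fineK// fin_num_measure.
transitivity (\prod_i e i)%:E.
  have := indep [set: 'I_n]%SET _ mAb.
  rewrite (_ : \bigcap_(i in _) _ =
    [set w | box A [tuple eps i w + b i | i < n]]); last first.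
    apply/seteqP; split => w /= wA i.
      by rewrite tnth_mktuple; apply: wA; rewrite /= inE.
    by move=> _; have := wA i; rewrite tnth_mktuple.
  move=> ->; rewrite (big_morph EFin EFinM erefl).
  apply: eq_big => i; first by rewrite inE.
  by rewrite fineK// fin_num_measure.
rewrite -(independent_integral_prod indep _ _ eE).
- rewrite [RHS]integral_mkcond; apply: eq_integral => w _.
  rewrite patchE big_split/= -/(likelihood b w).
  have [wA|wA] := boolP (w \in _).
    rewrite [X in _ * X]big1 ?mulr1// => i _.
    by rewrite indicE mem_set//; move: wA; rewrite inE => /(_ i);
      rewrite tnth_mktuple addr0.
  move: wA; rewrite notin_setE => /existsNP[i].
  rewrite tnth_mktuple addr0 => wA.
  by rewrite (bigD1 i)//= indicE memNset// mul0r mulr0.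
- move=> i; apply: measurable_funM; last exact: measurable_indic.
  apply: measurableT_comp => //.
  apply: (@measurable_funB _ _ _ _ (fun x => b i * x)) => //.
  exact: measurable_funM.
- by move=> i x; rewrite mulr_ge0// expR_ge0.
Qed.

(** The law of the shifted noise and the law of the noise under the density [likelihood eps b] agree
    on boxes, hence everywhere. *)
Lemma integral_shifted_noise (b : 'I_n -> R) (F : n.-tuple R -> \bar R) :
  measurable_fun setT F -> (forall t, 0 <= F t)%E ->
  (\int[P]_w F [tuple (eps i w + b i)%R | i < n] =
   \int[P]_w (F [tuple eps i w | i < n] * (likelihood b w)%:E))%E.
Proof.
move=> mF F0.
pose S (b' : 'I_n -> R) w : n.-tuple R := [tuple eps i w + b' i | i < n].
have mS b' : measurable_fun setT (S b') by exact: measurable_shifted_noise.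
have S0 w : [tuple eps i w | i < n] = S (fun=> 0) w.
  by apply: eq_from_tnth => i; rewrite !tnth_mktuple addr0.
under [in RHS]eq_integral do rewrite S0.
pose Q := density P (measurable_likelihood b) (likelihood_ge0 b).
rewrite -(@ge0_integral_density _ _ _ P _ (measurable_likelihood b)
  (likelihood_ge0 b) (F \o S (fun=> 0))); last 2 first.
- exact: (measurableT_comp mF (mS _)).
- by move=> w; exact: F0.
apply: (eq_ge0_integral_comp (mS b) (mS (fun=> 0))) => //.
unshelve epose (M1 := (pushforward P (S b) : {measure set _ -> \bar R}));
  first exact: mS.
unshelve epose (M2 := (pushforward Q (S (fun=> 0)) : {measure set _ -> \bar R}));
  first exact: mS.
apply: (@tuple_measure_unique _ _ M1 M2).
  by rewrite /M1/= /pushforward preimage_setT probability_setT ltry.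
by move=> A mA; exact: shifted_noise_box.
Qed.

End tilted_noise.

(** * Two-point bound and Assouad's lemma *)

(** For x <= y the difference of the two sides is x ((y - 2)^2 + x y). When the product x y is a
    constant, the inequality is linear in the minimum and in x + y, and can be integrated. *)
Lemma min_ge_mul (R : realFieldType) (x y : R) : 0 <= x -> 0 <= y ->
  x * y * 4 <= 4 * Num.min x y + x * y * (x + y).
Proof.
wlog xy : x y / x <= y => [H|] x0 y0.
  have /orP[xy|yx] := le_total x y; first exact: H.
  by have := H y x yx y0 x0; rewrite minC; lra.
rewrite (min_idPl xy).
have : 0 <= x * ((y - 2) ^+ 2 + x * y).
  by rewrite mulr_ge0// addr_ge0 ?sqr_ge0// mulr_ge0.
nra.
Qed.

Section two_points.
Context d (Omega : measurableType d) (R : realType) (P : probability Omega R).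
Variables (n : nat) (eps : 'I_n -> {RV P >-> R}).
Hypothesis Heps : gaussian_noise eps.

Lemma integral_likelihood (b : 'I_n -> R) :
  (\int[P]_w (likelihood eps b w)%:E = 1)%E.
Proof.
under eq_integral do rewrite -[(likelihood _ _ _)%:E]mul1e.
rewrite -(integral_shifted_noise Heps b (F := cst 1%E))//.
by rewrite integral_cst// mul1e; exact: probability_setT.
Qed.

(** Opposite shifts cancel the terms linear in the noise, so the product is deterministic. *)
Lemma likelihoodMN (b : 'I_n -> R) w :
  likelihood eps b w * likelihood eps (fun i => - b i) w =
  expR (- \sum_i b i ^+ 2).
Proof.
rewrite /likelihood -big_split/= -sumrN expR_sum; apply: eq_bigr => i _.
by rewrite -expRD; congr expR; field.
Qed.

(** With k the constant value of the product and both likelihoods of integral 1, [min_ge_mul]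
    integrates to 4 k <= 4 E[min] + 2 k. *)
Lemma integral_min_likelihood (b : 'I_n -> R) :
  ((expR (- \sum_i b i ^+ 2) / 2)%:E <=
   \int[P]_w (Num.min (likelihood eps b w)
                      (likelihood eps (fun i => - b i) w))%:E)%E.
Proof.
set k := expR _; set L := likelihood eps b.
set L' := likelihood eps (fun i => - b i).
have mL : measurable_fun setT L by exact: measurable_likelihood.
have mL' : measurable_fun setT L' by exact: measurable_likelihood.
have L0 w : 0 <= L w by exact: likelihood_ge0.
have L'0 w : 0 <= L' w by exact: likelihood_ge0.
have k0 : 0 <= k by exact: expR_ge0.
have min0 w : 0 <= Num.min (L w) (L' w) by rewrite le_min L0 L'0.
have mmin : measurable_fun setT (fun w => Num.min (L w) (L' w)).
  exact: measurable_minr.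
have IL : (\int[P]_w (L w)%:E = 1)%E by exact: integral_likelihood.
have IL' : (\int[P]_w (L' w)%:E = 1)%E by exact: integral_likelihood.
have : (\int[P]_w (k * 4)%:E <=
    \int[P]_w ((4%:E * (Num.min (L w) (L' w))%:E) +
      (k%:E * ((L w)%:E + (L' w)%:E))))%E.
  apply: ge0_le_integral => //.
  - by move=> w _; rewrite lee_fin mulr_ge0.
  - apply: emeasurable_funD; apply: emeasurable_funM => //.
      exact/measurable_EFinP.
    by apply: emeasurable_funD; exact/measurable_EFinP.
  - move=> w _; rewrite -EFinD lee_fin.
    by rewrite /k -(likelihoodMN b w); exact: min_ge_mul.
rewrite integral_cst// [X in (_ * X <= _)%E]probability_setT mule1.
rewrite ge0_integralD//=; last 4 first.
- by move=> w _; rewrite -EFinM lee_fin mulr_ge0.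
- by apply: emeasurable_funM => //; exact/measurable_EFinP.
- by move=> w _; rewrite -EFinD -EFinM lee_fin mulr_ge0// addr_ge0.
- apply: emeasurable_funM => //.
  by apply: emeasurable_funD; exact/measurable_EFinP.
rewrite ge0_integralZl//=; last 2 first.
- exact/measurable_EFinP.
- by move=> w _; rewrite lee_fin.
rewrite ge0_integralZl//=; last 2 first.
- by apply: emeasurable_funD; exact/measurable_EFinP.
- by move=> w _; rewrite -EFinD lee_fin addr_ge0.
rewrite ge0_integralD//=; last 4 first.
- by move=> w _; rewrite lee_fin.
- exact/measurable_EFinP.
- by move=> w _; rewrite lee_fin.
- exact/measurable_EFinP.
rewrite IL IL'.
have : (0 <= \int[P]_w (Num.min (L w) (L' w))%:E)%E.
  by apply: integral_ge0 => w _; rewrite lee_fin.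
case: (\int[P]_w _)%E => [r||]; rewrite ?leey// => r0.
by rewrite -EFinD !lee_fin; lra.
Qed.

Lemma measurable_observations (sigma : R) (mu : R -> R) :
  measurable_fun [set: Omega] (observations eps sigma mu).
Proof.
apply/measurable_fun_tnthP => i; rewrite /comp /=.
under eq_fun do rewrite tnth_mktuple.
apply: measurable_funD => //.
exact: measurable_funM.
Qed.

(** Seen from the midpoint of the two means, the data are shifted by [b] and by [- b]. After the
    change of measure both expectations refer to the same noise, and G L + G' L' >= h min(L, L'). *)
Lemma two_point_bound (sigma K h : R) (mu mu' : R -> R)
    (G G' : n.-tuple R -> \bar R) :
  0 < sigma -> 0 <= h ->
  measurable_fun setT G -> measurable_fun setT G' ->
  (forall y, 0 <= G y)%E -> (forall y, 0 <= G' y)%E ->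
  (forall y, h%:E <= G y + G' y)%E ->
  \sum_(i < n) (mu (i%:R / n%:R) - mu' (i%:R / n%:R)) ^+ 2
    <= 4 * sigma ^+ 2 * K ->
  ((h * (expR (- K) / 2))%:E <=
   \int[P]_w G (observations eps sigma mu w) +
   \int[P]_w G' (observations eps sigma mu' w))%E.
Proof.
move=> s0 h0 mG mG' G0 G'0 hG dist.
(* Half the difference of the means and their midpoint, in units of [sigma]; [A] turns noise into
   data whose mean is the midpoint. *)
pose b i := (mu (i%:R / n%:R) - mu' (i%:R / n%:R)) / (2 * sigma).
pose c i := (mu (i%:R / n%:R) + mu' (i%:R / n%:R)) / (2 * sigma).
pose A (t : n.-tuple R) : n.-tuple R := [tuple sigma * (tnth t i + c i) | i < n].
have mA : measurable_fun setT A.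
  apply/measurable_fun_tnthP => i; rewrite /comp /=.
  under eq_fun do rewrite tnth_mktuple.
  apply: measurable_funM => //; apply: measurable_funD => //.
  exact: measurable_tnth.
have Kb : expR (- K) <= expR (- \sum_(i < n) b i ^+ 2).
  rewrite ler_expR lerN2 /b.
  under eq_bigr do rewrite expr_div_n.
  rewrite -mulr_suml ler_pdivrMr; last by rewrite exprn_gt0// mulr_gt0.
  by rewrite (le_trans dist)// exprMn; lra.
have s_neq0 : sigma != 0 by rewrite gt_eqF.
have -> : (\int[P]_w G (observations eps sigma mu w) =
    \int[P]_w (G (A [tuple eps i w | i < n]) * (likelihood eps b w)%:E))%E.
  rewrite -(integral_shifted_noise Heps b (F := G \o A)).
  - apply: eq_integral => w _; congr G; apply: eq_from_tnth => i.
    rewrite /A !tnth_mktuple /b /c.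
    by field.
  - exact: measurableT_comp.
  - by move=> t; exact: G0.
have -> : (\int[P]_w G' (observations eps sigma mu' w) =
    \int[P]_w (G' (A [tuple eps i w | i < n]) *
      (likelihood eps (fun i => (- b i)%R) w)%:E))%E.
  rewrite -(integral_shifted_noise Heps (fun i => (- b i)%R) (F := G' \o A)).
  - apply: eq_integral => w _; congr G'; apply: eq_from_tnth => i.
    rewrite /A !tnth_mktuple /b /c.
    by field.
  - exact: measurableT_comp.
  - by move=> t; exact: G'0.
set L := likelihood eps b.
set L' := likelihood eps (fun i => - b i).
have mL : measurable_fun setT L by exact: measurable_likelihood.
have mL' : measurable_fun setT L' by exact: measurable_likelihood.
have L0 w : 0 <= L w by exact: likelihood_ge0.
have L'0 w : 0 <= L' w by exact: likelihood_ge0.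
have mT : measurable_fun [set: Omega] (fun w => A [tuple eps i w | i < n]).
  pose E w : n.-tuple R := [tuple eps i w | i < n].
  have mE : measurable_fun setT E.
    apply/measurable_fun_tnthP => i; rewrite (_ : _ \o E = eps i)//.
    by apply/funext => w; rewrite /= tnth_mktuple.
  exact: (measurableT_comp mA mE).
have mGL : measurable_fun [set: Omega] (fun w =>
    G (A [tuple eps i w | i < n]) * (L w)%:E)%E.
  apply: emeasurable_funM; last exact/measurable_EFinP.
  exact: (measurableT_comp mG mT).
have mGL' : measurable_fun [set: Omega] (fun w =>
    G' (A [tuple eps i w | i < n]) * (L' w)%:E)%E.
  apply: emeasurable_funM; last exact/measurable_EFinP.
  exact: (measurableT_comp mG' mT).
rewrite -ge0_integralD//; last 2 first.
- by move=> w _; rewrite mule_ge0// lee_fin.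
- by move=> w _; rewrite mule_ge0// lee_fin.
have min0 w : 0 <= Num.min (L w) (L' w) by rewrite le_min L0 L'0.
have mmin : measurable_fun setT (fun w => Num.min (L w) (L' w)).
  exact: measurable_minr.
apply: (@le_trans _ _ (\int[P]_w (h%:E * (Num.min (L w) (L' w))%:E)))%E.
  rewrite ge0_integralZl//=; last 2 first.
  - exact/measurable_EFinP.
  - by move=> w _; rewrite lee_fin.
  rewrite EFinM lee_wpmul2l ?lee_fin//.
  apply: le_trans (integral_min_likelihood b).
  by rewrite lee_fin ler_wpM2r.
apply: ge0_le_integral => //.
- by move=> w _; rewrite mule_ge0// lee_fin.
- by apply: emeasurable_funM => //; exact/measurable_EFinP.
- exact: emeasurable_funD.
move=> w _; apply: (le_trans (lee_wpmul2r _ (hG (A [tuple eps i w | i < n])))).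
  by rewrite lee_fin.
rewrite ge0_muleDl//; apply: leeD; apply: lee_wpmul2l => //.
  by rewrite lee_fin ge_min lexx.
by rewrite lee_fin ge_min lexx orbT.
Qed.

End two_points.

(** Hoelder's inequality against the indicator of [I], whose norm for the conjugate exponent q is
    t^(1/q) with 1/q = 1 - 1/p. The case p = 1 is separate, q being infinite there. *)
Lemma Lnorm_ge_integral d (T : measurableType d) (R : realType)
    (mu : {measure set T -> \bar R}) (p t : R) (f : T -> R) (I : set T) :
  1 <= p -> 0 < t -> measurable_fun setT f -> measurable I ->
  mu I = t%:E ->
  ((t `^ (p^-1 - 1))%:E * \int[mu]_(x in I) `|f x|%:E
    <= 'N[mu]_p%:E[EFin \o f])%E.
Proof.
move=> p1 t0 mf mI It.
have p0 : 0 < p by exact: lt_le_trans p1.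
pose J : T -> R := \1_I.
have mJ : measurable_fun setT J by exact: measurable_indic.
have -> : (\int[mu]_(x in I) `|f x|%:E = 'N[mu]_1 [EFin \o (f \* J)%R])%E.
  rewrite Lnorm1 integral_mkcond; apply: eq_integral => x _.
  rewrite patchE /= /J indicE.
  by case: ifP => xI; rewrite ?mulr1 ?mulr0 ?normr0.
have [<-|p_neq1] := eqVneq 1 p.
  rewrite invr1 subrr powRr0 mul1e !Lnorm1.
  apply: ge0_le_integral => //.
  - apply: measurableT_comp => //; apply/measurable_EFinP.
    exact: measurable_funM.
  - by apply: measurableT_comp => //; exact/measurable_EFinP.
  move=> x _; rewrite /= lee_fin /J indicE normrM.
  by case: (_ \in _); rewrite ?normr1 ?normr0 ?mulr1 ?mulr0.
have {}p1 : 1 < p by rewrite lt_neqAle p_neq1.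
pose q := p / (p - 1).
have q0 : 0 < q by rewrite divr_gt0// subr_gt0.
have pq : p^-1 + q^-1 = 1.
  by rewrite /q invf_div mulrBl divff ?gt_eqF// mul1r addrC subrK.
have Jq : ('N[mu]_q%:E [EFin \o J] = (t `^ q^-1)%:E)%E.
  rewrite unlock -poweR_EFin; congr (_ `^ _)%E.
  rewrite -It -[in RHS](setIT I) -integral_indic//; apply: eq_integral => x _.
  rewrite /= /J indicE.
  by case: (_ \in _); rewrite ?normr1 ?normr0 ?powR1 ?powR0// gt_eqF.
have := hoelder mu mf mJ p0 q0 pq; rewrite Jq => H.
have tE : (p^-1 - 1) = - q^-1 by rewrite -pq; ring.
rewrite tE; apply: (le_trans (lee_wpmul2l _ H)).
  by rewrite lee_fin powR_ge0.
rewrite muleCA -EFinM -powRD ?addNr ?powRr0 ?mule1//.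
by rewrite (gt_eqF t0) implybT.
Qed.

Lemma Lp_norm01_ge (R : realType) (p t : R) (f : R -> R) (I : set R) :
  1 <= p -> 0 < t -> measurable_fun setT f -> measurable I ->
  I `<=` `[0, 1[ -> lebesgue_measure I = t%:E ->
  ((t `^ (p^-1 - 1))%:E * \int[lebesgue_measure]_(x in I) `|f x|%:E
    <= Lp_norm01 p f)%E.
Proof.
move=> p1 t0 mf mI I01 It; rewrite /Lp_norm01.
pose nu := mrestr (@lebesgue_measure R) (measurable_itv `[0%R, 1%R[).
rewrite (eq_measure_integral nu); last first.
  move=> A mA AI; rewrite /nu /= /mrestr setIidl//.
  exact: subset_trans I01.
apply: Lnorm_ge_integral => //.
by rewrite /= /mrestr setIidl.
Qed.

Lemma measurable_step_eval (R : realType) (s : stepFun R) :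
  measurable_fun setT (s : R -> R).
Proof. by apply: measurable_sum => k; exact: measurable_funM. Qed.

(* Unlike [ge0_le_integral], no measurability: the loss of an estimator is not
   shown to be measurable. *)
Lemma ge0_le_integralT d (T : measurableType d) (R : realType)
    (mu : {measure set T -> \bar R}) (f g : T -> \bar R) :
  (forall x, 0 <= f x)%E -> (forall x, f x <= g x)%E ->
  (\int[mu]_x f x <= \int[mu]_x g x)%E.
Proof.
move=> f0 fg; have g0 x : (0 <= g x)%E by exact: le_trans (fg x).
rewrite !ge0_integralTE//; apply: ereal_sup_le => _ [h hf <-].
by exists h => // x; exact: le_trans (fg x).
Qed.

Definition flip m (k : 'I_m) (t : {ffun 'I_m -> bool}) : {ffun 'I_m -> bool} :=
  [ffun i => t i (+) (i == k)].

Lemma flipK m (k : 'I_m) : involutive (flip k).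
Proof. by move=> t; apply/ffunP => i; rewrite !ffunE addbK. Qed.

(** * Local losses of an estimator *)

Section estimation_loss.
Context (R : realType) (n : nat) (muhat : n.-tuple R -> R -> R).
Hypothesis Hmuhat : estimator muhat.
Local Notation leb := (@lebesgue_measure R).

(** The loss on one block. The exponent 1 makes it additive over disjoint blocks. *)
Definition L1_loss (mu : R -> R) (I : set R) (y : n.-tuple R) : \bar R :=
  (\int[leb]_(x in I) `|muhat y x - mu x|%:E)%E.

Lemma L1_loss_ge0 mu I y : (0 <= L1_loss mu I y)%E.
Proof. by apply: integral_ge0 => x _; rewrite lee_fin. Qed.

Let measurable_loss (mu : R -> R) : measurable_fun setT mu ->
  measurable_fun [set: n.-tuple R * R] (fun z => `|muhat z.1 z.2 - mu z.2|).
Proof.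
move=> mmu; apply: measurableT_comp => //; apply: measurable_funB => //.
exact: measurableT_comp.
Qed.

Let measurable_muhat (y : n.-tuple R) : measurable_fun setT (muhat y).
Proof. exact: (measurableT_comp Hmuhat (measurable_pair1 y)). Qed.

(** Tonelli's theorem, applied to the integrand as a jointly measurable function of the data and the
    point. *)
Lemma measurable_L1_loss (mu : R -> R) (I : set R) :
  measurable_fun setT mu -> measurable I ->
  measurable_fun setT (L1_loss mu I).
Proof.
move=> mmu mI.
pose f (z : n.-tuple R * measurableTypeR R) : \bar R :=
  (`|muhat z.1 z.2 - mu z.2| * \1_I z.2)%:E.
have -> : L1_loss mu I = fubini_F leb f.
  apply/funext => y; rewrite /L1_loss /fubini_F [LHS]integral_mkcond.
  apply: eq_integral => x _; rewrite patchE /f /= indicE.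
  by case: ifP; rewrite ?mulr1 ?mulr0.
apply: measurable_fun_fubini_tonelli_F.
  apply/measurable_EFinP; apply: measurable_funM; first exact: measurable_loss.
  by apply: measurableT_comp => //; exact: measurable_indic.
by move=> z; rewrite lee_fin mulr_ge0.
Qed.

Lemma L1_loss_two_point (mu mu' : R -> R) (I : set R) (eta delta : R) y :
  measurable_fun setT mu -> measurable_fun setT mu' -> measurable I ->
  leb I = delta%:E -> 0 <= eta ->
  (forall x, I x -> eta <= `|mu x - mu' x|) ->
  ((eta * delta)%:E <= L1_loss mu I y + L1_loss mu' I y)%E.
Proof.
move=> mmu mmu' mI Idelta eta0 sep.
have ml (nu : R -> R) : measurable_fun setT nu ->
    measurable_fun (I : set (measurableTypeR R)) (fun x => `|muhat y x - nu x|%:E).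
  move=> mnu; apply/measurable_EFinP; apply: measurable_funTS.
  apply: measurableT_comp => //.
  exact: (measurable_funB (measurable_muhat y)).
rewrite /L1_loss -ge0_integralD//=; last 2 first.
- exact: ml.
- exact: ml.
have -> : ((eta * delta)%:E = \int[leb]_(x in I) (cst eta%:E) x)%E.
  by rewrite integral_cst// EFinM -Idelta.
apply: ge0_le_integral => //=.
- by apply: emeasurable_funD; exact: ml.
move=> x Ix; rewrite -EFinD lee_fin (le_trans (sep x Ix))//.
by rewrite (distrC (muhat y x)) (le_trans _ (ler_normD _ _))// addrA subrK.
Qed.

Lemma Lp_norm01_ge_sum (p delta : R) (m : nat) (I : 'I_m -> set R)
    (mu : R -> R) y :
  1 <= p -> (0 < m)%N -> 0 < delta -> measurable_fun setT mu ->
  (forall k, measurable (I k)) -> (forall k, I k `<=` `[0, 1[) ->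
  trivIset setT I -> (forall k, leb (I k) = delta%:E) ->
  (((m%:R * delta) `^ (p^-1 - 1))%:E * \sum_k L1_loss mu (I k) y <=
   Lp_norm01 p (fun x => muhat y x - mu x)%R)%E.
Proof.
move=> p1 m0 d0 mmu mI I01 tI Id.
pose U := \big[setU/set0]_(k < m) I k.
have tI' : trivIset [set` index_enum 'I_m] I by exact: sub_trivIset tI.
have mf : measurable_fun setT (fun x => muhat y x - mu x).
  exact: (measurable_funB (measurable_muhat y)).
have UE : (\sum_k L1_loss mu (I k) y =
    \int[leb]_(x in U) `|muhat y x - mu x|%:E)%E.
  rewrite ge0_integral_bigsetU//.
  - exact: index_enum_uniq.
  - apply/measurable_EFinP; apply: measurable_funTS.
    by apply: measurableT_comp.
rewrite UE; apply: Lp_norm01_ge => //.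
- by rewrite mulr_gt0// ltr0n.
- exact: bigsetU_measurable.
- apply: (big_ind (fun A => A `<=` `[0, 1[%classic)) => //.
  by move=> A B; rewrite subUset; split.
- rewrite [LHS]measure_bigsetU_ord//.
  rewrite (eq_bigr (fun=> delta%:E)) => [|k _]; last exact: Id.
  by rewrite sumEFin sumr_const card_ord mulr_natl.
Qed.

End estimation_loss.

(** Since [flip k] is an involution of the cube, the sums over t of [l t k] and of [l (flip k t) k]
    coincide; hence [l t k] is at least c / 2 on average over t. *)
Lemma assouad_average (R : realType) (m : nat)
    (l : {ffun 'I_m -> bool} -> 'I_m -> R) (c r q : R) :
  0 <= q -> (forall t, q * \sum_k l t k <= r) ->
  (forall t k, c <= l t k + l (flip k t) k) ->
  q * (m%:R * (c / 2)) <= r.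
Proof.
move=> q0 lr lc.
pose N : R := \sum_(t : {ffun 'I_m -> bool}) 1.
have N0 : 0 < N.
  rewrite /N (bigD1 [ffun=> true])//= ltr_pwDl//.
  by apply: sumr_ge0 => t _; exact: ler01.
have sumc k : c / 2 * N <= \sum_t l t k.
  have E : \sum_t l (flip k t) k = \sum_t l t k.
    by rewrite [RHS](reindex_inj (inv_inj (flipK k))).
  have : c * N <= \sum_t (l t k + l (flip k t) k).
    by rewrite mulr_sumr; apply: ler_sum => t _; rewrite mulr1.
  rewrite big_split/= E; lra.
rewrite -(ler_pM2r N0).
apply: (@le_trans _ _ (\sum_t q * \sum_k l t k)); last first.
  by rewrite [leRHS]mulr_sumr; apply: ler_sum => t _; rewrite mulr1.
rewrite -mulr_sumr -mulrA ler_wpM2l// exchange_big/=.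
apply: (@le_trans _ _ (\sum_(k < m) (c / 2 * N))); last exact: ler_sum.
by rewrite sumr_const card_ord -[leRHS]mulr_natl -[leLHS]mulrA.
Qed.

Section assouad.
Context (R : realType) d (Omega : measurableType d) (P : probability Omega R).
Variables (n : nat) (eps : 'I_n -> {RV P >-> R}).
Hypothesis Heps : gaussian_noise eps.

(** The worst risk [M] of an estimator dominates its risk at every vertex [s t]. Hoelder bounds that
    risk below by [q] times the sum of the expected block losses [L t k], the two-point bound
    controls [L t k + L (flip k t) k], and averaging over the cube concludes. *)
Lemma minimax_risk_ge (sigma p K eta delta : R) (m : nat)
    (B : set (stepFun R)) (g : R -> R) (I : 'I_m -> set R) :
  0 < sigma -> 1 <= p -> (0 < m)%N -> 0 <= eta -> 0 < delta ->
  (forall k, measurable (I k)) -> (forall k, I k `<=` `[0, 1[) ->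
  trivIset setT I -> (forall k, lebesgue_measure (I k) = delta%:E) ->
  (forall k, eta ^+ 2 * \sum_(i < n) \1_(I k) (i%:R / n%:R)
     <= 4 * sigma ^+ 2 * K) ->
  (forall t : {ffun 'I_m -> bool}, exists s : stepFun R, B s /\
     forall x, s x = g x + eta * \sum_k (t k)%:R * \1_(I k) x) ->
  ((expR (- K) / 4 * (eta * (m%:R * delta) `^ p^-1))%:E
     <= minimax_risk eps sigma p B)%E.
Proof.
move=> s0 p1 m0 eta0 d0 mI I01 tI Id count /choice[s Hs].
apply: le_ereal_inf_tmp => _ [muhat Hmuhat <-]; set M := ereal_sup _.
have riskM t : (risk eps sigma p muhat (s t) <= M)%E.
  by apply: ereal_sup_ubound; exists (s t) => //; have [] := Hs t.
have ms t : measurable_fun setT (s t : R -> R) by exact: measurable_step_eval.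
pose L t k := (\int[P]_w
  L1_loss muhat (s t) (I k) (observations eps sigma (s t) w))%E.
have mL t t' k : measurable_fun [set: Omega]
    (fun w => L1_loss muhat (s t) (I k) (observations eps sigma (s t') w)).
  apply: (measurableT_comp (measurable_L1_loss Hmuhat (ms t) (mI k))).
  exact: measurable_observations.
have L0 t k : (0 <= L t k)%E.
  by apply: integral_ge0 => w _; exact: L1_loss_ge0.
pose q := (m%:R * delta) `^ (p^-1 - 1).
have q0 : 0 < q by rewrite powR_gt0// mulr_gt0// ltr0n.
have LM t : (q%:E * \sum_k L t k <= M)%E.
  apply: le_trans (riskM t); rewrite /risk.
  rewrite -ge0_integral_sum//; last by move=> k w _; exact: L1_loss_ge0.
  rewrite -ge0_integralZl//; last 3 first.
  - exact: emeasurable_sum.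
  - by move=> w _; apply: sume_ge0 => k _; exact: L1_loss_ge0.
  - by rewrite lee_fin ltW.
  apply: ge0_le_integralT => w.
    apply: mule_ge0; first by rewrite lee_fin ltW.
    by apply: sume_ge0 => k _; exact: L1_loss_ge0.
  exact: Lp_norm01_ge_sum.
have sflip t k x : s t x - s (flip k t) x =
    eta * ((t k)%:R - (~~ t k)%:R) * \1_(I k) x.
  have [_ ->] := Hs t; have [_ ->] := Hs (flip k t).
  rewrite (bigD1 k)//= [in X in _ - X](bigD1 k)//= ffunE eqxx addbT.
  rewrite [in X in _ - X](eq_bigr (fun i => (t i)%:R * \1_(I i) x)).
    by ring.
  by move=> i /negbTE ik; rewrite ffunE ik addbF.
have LL t k : ((eta * delta * (expR (- K) / 2))%:E <= L t k + L (flip k t) k)%E.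
  apply: two_point_bound => //.
  - by rewrite mulr_ge0// ltW.
  - exact: measurable_L1_loss.
  - exact: measurable_L1_loss.
  - by move=> y; exact: L1_loss_ge0.
  - by move=> y; exact: L1_loss_ge0.
  - move=> y; apply: L1_loss_two_point => //.
    move=> x Ix; rewrite sflip indicE mem_set// mulr1 normrM ger0_norm//.
    by case: (t k); rewrite ?subr0 ?sub0r ?normrN normr1 mulr1.
  - apply: le_trans (count k); rewrite mulr_sumr; apply: ler_sum => i _.
    rewrite sflip indicE.
    by case: (_ \in _); case: (t k) => /=; lra.
have M0 : (0 <= M)%E.
  apply: le_trans (LM [ffun=> true]); apply: mule_ge0.
    by rewrite lee_fin ltW.
  by apply: sume_ge0 => k _; exact: L0.
(* An infinite [M] leaves nothing to prove. A finite one makes every [L t k] finite because q > 0,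
   so that the averaging takes place among real numbers. *)
case: M M0 LM {riskM} => [r||] //; last by move=> *; rewrite leey.
move=> r0 LM.
have Lfin t k : L t k \is a fin_num.
  rewrite ge0_fin_numE//.
  have : (q%:E * L t k <= r%:E)%E.
    apply: le_trans (LM t); rewrite lee_wpmul2l ?lee_fin ?(ltW q0)//.
    by rewrite (bigD1 k)//= leeDl//; apply: sume_ge0 => i _; exact: L0.
  rewrite -lee_pdivlMl// => /le_lt_trans; apply.
  by rewrite -EFinM ltry.
rewrite lee_fin.
apply: (@le_trans _ _ (q * (m%:R * (eta * delta * (expR (- K) / 2) / 2)))).
  have T0 : 0 < m%:R * delta by rewrite mulr_gt0// ltr0n.
  have -> : (m%:R * delta) `^ p^-1 = q * (m%:R * delta).
    rewrite -[X in q * X]powRr1 ?(ltW T0)// -powRD ?subrK//.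
    by rewrite (gt_eqF T0) implybT.
  by rewrite le_eqVlt; apply/orP; left; apply/eqP; field.
apply: (@assouad_average _ _ (fun t k => fine (L t k)) _ _ _ (ltW q0)).
- move=> t; rewrite -lee_fin EFinM -sumEFin.
  by under eq_bigr do rewrite fineK//; exact: LM.
- by move=> t k; rewrite -lee_fin EFinD !fineK//; exact: LL.
Qed.

End assouad.

(** * Families of step functions *)

Lemma sum_design_itv_le (R : realType) (n : nat) (x y : R) : (0 < n)%N ->
  x <= y ->
  \sum_(i < n) \1_(`[x, y[%classic : set R) (i%:R / n%:R : R)
    <= n%:R * (y - x) + 1.
Proof.
move=> n0 xy; have n0' : 0 < n%:R :> R by rewrite ltr0n.
set u := n%:R * x; set v := n%:R * y.
have uv : u <= v by rewrite ler_wpM2l// ltW.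
(* An index counted on the left contributes a full unit step of this
   truncation. *)
pose c (i : nat) : R := Num.max u (Num.min (v + 1) i%:R).
have cE i : \1_(`[x, y[%classic : set R) (i%:R / n%:R : R) <= c i.+1 - c i.
  have c_nd : c i <= c i.+1.
    by rewrite le_max2 ?lexx// le_min2 ?lexx ?ler_nat.
  rewrite indicE; case: (boolP (_ \in _)); last by rewrite subr_ge0.
  rewrite inE/= in_itv/= ler_pdivlMr// ltr_pdivrMr// => /andP[ui iv].
  have {}ui : u <= i%:R by rewrite /u mulrC.
  have {}iv : i%:R < v by rewrite /v mulrC.
  have iS : i.+1%:R = i%:R + 1 :> R by rewrite -natr1.
  rewrite /c iS (min_idPr _); last by lra.
  rewrite (min_idPr _); last by lra.
  rewrite (max_idPr _); last by lra.
  by rewrite (max_idPr _); lra.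
apply: (@le_trans _ _ (\sum_(i < n) (c i.+1 - c i))); first exact: ler_sum.
rewrite -(big_mkord xpredT (fun i => c i.+1 - c i)) telescope_sumr//.
rewrite mulrBr -/u -/v lerBlDr.
have : c n <= v + 1 by rewrite ge_max ge_min lexx/= andbT; lra.
have : u <= c 0%N by rewrite le_max lexx.
lra.
Qed.

Lemma sum_double (R : realType) (F : nat -> R) (m : nat) :
  \sum_(0 <= j < m.*2) F j = \sum_(0 <= k < m) (F k.*2 + F k.*2.+1).
Proof.
elim: m => [|m IH]; first by rewrite !big_geq.
by rewrite doubleS !big_nat_recr//= IH addrA.
Qed.

Section constant_functions.
Context (R : realType).

Lemma const_step_subproof (k : nat) : (k <= 0)%N -> (k%:R : R) < k.+1%:R.
Proof. by rewrite ltr_nat. Qed.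

(** Without change-points only the values 0 and 1 of [cpt] at 0 and 1 matter, and the condition on
    levels is vacuous. *)
Definition const_step (c : R) : stepFun R :=
  @StepFun R 0 (fun j => j%:R) (fun=> c) erefl erefl const_step_subproof
    (fun k (k0 : (k < 0)%N) => False_ind _ (notF k0)).

Lemma const_stepE (c x : R) : const_step c x = c * \1_(`[0, 1[%classic : set R) x.
Proof. by rewrite /step_eval /= big_ord1. Qed.

Lemma const_step_class (nu e L c : R) : nu <= 1 ->
  step_class nu e L (const_step c).
Proof.
move=> nu1; split => //=.
by rewrite /min_segment big_ltn// big_geq//= subr0 normr1 minxx.
Qed.

End constant_functions.

(** * Step functions perturbed block by block *)

Section blocks.
Context (R : realType) (m' : nat) (w h delta eta : R).
Local Notation m := m'.+1.
Hypotheses (w0 : 0 < w) (delta0 : 0 <= delta) (eta0 : 0 <= eta).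
Hypotheses (wl : w <= h - delta) (wr : w <= m%:R^-1 - h).
Implicit Types t : {ffun 'I_m -> bool}.

(** Each of the m cells of length 1/m has two segments: the even one starts at k/m with level 0, the
    odd one at k/m + h - t_k delta with level 1 + eta t_k. Taking delta = 0 perturbs levels only,
    eta = 0 moves jumps only. Up to index 2 m, [t] is read at odd j only, where j./2 < m and [inord]
    is exact. *)
Definition block_cpt t (j : nat) : R :=
  j./2%:R / m%:R + (if odd j then h - (t (inord j./2))%:R * delta else 0).

Definition block_level t (j : nat) : R :=
  if odd j then 1 + eta * (t (inord j./2))%:R else 0.

Lemma block_cpt_diff t j : block_cpt t j.+1 - block_cpt t j =
  if odd j then m%:R^-1 - (h - (t (inord j./2))%:R * delta)
  else h - (t (inord j./2))%:R * delta.
Proof.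
rewrite /block_cpt -[j.+1./2]/(uphalf j) uphalf_half oddS.
case: (odd j); cbn [negb]; last by rewrite add0n; ring.
by rewrite natrD mulrDl mul1r; ring.
Qed.

Lemma block_cpt_gap t j : w <= block_cpt t j.+1 - block_cpt t j.
Proof.
have aux (r z : R) (b : bool) : w <= r - h -> 0 <= z <= delta ->
    w <= if b then r - (h - z) else h - z.
  by move: w0 delta0 wl => ? ? ? ? /andP[z0 zd]; case: b; lra.
rewrite block_cpt_diff; apply: aux => //.
by case: (t _); rewrite ?mul0r ?mul1r delta0 lexx.
Qed.

Lemma block_cpt_lt t k : (k <= m'.*2.+1)%N -> block_cpt t k < block_cpt t k.+1.
Proof. by move=> _; move: w0 (block_cpt_gap t k); lra. Qed.

Lemma block_jump t j :
  1 <= `|block_level t j.+1 - block_level t j| <= 1 + eta.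
Proof.
have aux (b : bool) : 1 <= `|1 + eta * b%:R| <= 1 + eta.
  have b0 : 0 <= eta * b%:R by rewrite mulr_ge0.
  rewrite ger0_norm ?addr_ge0// lerDl b0 lerD2l ler_piMr//.
  by case: b {b0}.
by rewrite /block_level oddS -[j.+1./2]/(uphalf j) uphalf_half;
  case: (odd j); cbn [negb]; rewrite ?sub0r ?subr0 ?normrN aux.
Qed.

Lemma block_level_neq t k : (k < m'.*2.+1)%N ->
  block_level t k != block_level t k.+1.
Proof.
move=> _; have /andP[] := block_jump t k.
by move=> + _; apply: contraL => /eqP ->; rewrite subrr normr0 ler10.
Qed.

Lemma block_cpt_first t : block_cpt t 0 = 0.
Proof. by rewrite /block_cpt/= mul0r addr0. Qed.

Lemma block_cpt_last t : block_cpt t m'.*2.+2 = 1.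
Proof.
by rewrite /block_cpt/= odd_double/= addr0 doubleK divff// pnatr_eq0.
Qed.

Definition block_step t : stepFun R :=
  StepFun (block_cpt_first t) (block_cpt_last t) (@block_cpt_lt t)
    (@block_level_neq t).

Lemma block_step_class t (e L : R) : e < 1 -> 1 + eta <= L ->
  step_class w e L (block_step t).
Proof.
move=> e1 etaL; split => [|_].
  rewrite /min_segment /=; apply: (big_ind (fun z => w <= z)).
  - exact: le_trans (block_cpt_gap t 0) (ler_norm _).
  - by move=> x y wx wy; rewrite le_min wx wy.
  - by move=> k _; exact: le_trans (block_cpt_gap t k) (ler_norm _).
have jump j : (0 < j)%N ->
    1 <= `|block_level t j - block_level t j.-1| <= 1 + eta.
  by case: j => // j _; exact: block_jump.
have jump0 := block_jump t 0; split; [|split].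
- rewrite /min_jump big_nat; apply: (big_ind (fun z => e <= z)) => /=.
  + by have /andP[] := jump0; lra.
  + by move=> x y ex ey; rewrite le_min ex ey.
  + by move=> k /andP[k0 _]; have /andP[] := jump k k0; lra.
- apply: (@le_trans _ _ `|block_level t 1 - block_level t 0|).
    exact: bigmin_le_id.
  exact: bigmax_ge_id.
- rewrite /max_jump big_nat; apply: (big_ind (fun z => z <= L)) => /=.
  + by have /andP[] := jump0; lra.
  + by move=> x y ex ey; rewrite ge_max ex ey.
  + by move=> k /andP[k0 _]; have /andP[] := jump k k0; lra.
Qed.

(** Even segments have level 0, so one term per cell survives. *)
Lemma block_stepE t x : block_step t x = \sum_(k < m)
  (1 + eta * (t k)%:R) *
  \1_(`[k%:R / m%:R + (h - (t k)%:R * delta), k.+1%:R / m%:R[%classic : set R) x.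
Proof.
rewrite /step_eval /=.
pose F j := block_level t j *
  \1_(`[block_cpt t j, block_cpt t j.+1[%classic : set R) x.
rewrite -(big_mkord xpredT F) -doubleS sum_double big_mkord.
apply: eq_bigr => k _; rewrite /F /block_level /block_cpt /= !odd_double/=.
by rewrite mul0r add0r !doubleK uphalf_double addr0 !inord_val.
Qed.

End blocks.

Lemma cell_subset (R : realType) (m' : nat) (h delta : R) (k : 'I_m'.+1) :
  0 <= h - delta -> h <= m'.+1%:R^-1 ->
  `[k%:R / m'.+1%:R + (h - delta), k%:R / m'.+1%:R + h[%classic `<=`
    `[k%:R / m'.+1%:R, k.+1%:R / m'.+1%:R[%classic.
Proof.
move=> hd hm x /=; rewrite !in_itv/= -[k.+1%:R]natr1 mulrDl mul1r.
move=> /andP[xl xr]; apply/andP; split.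
  by rewrite (le_trans _ xl)// lerDl.
by rewrite (lt_le_trans xr)// lerD2l.
Qed.

Section cells.
Context (R : realType) (m' : nat) (I : 'I_m'.+1 -> set R).
Hypothesis I_cell : forall k : 'I_m'.+1,
  I k `<=` `[k%:R / m'.+1%:R, k.+1%:R / m'.+1%:R[%classic.

Lemma cell_trivIset : trivIset setT I.
Proof.
have aux (i j : 'I_m'.+1) x : I i x -> I j x -> (i <= j)%N.
  move=> /I_cell /=; rewrite in_itv/= => /andP[ix _].
  move=> /I_cell /=; rewrite in_itv/= => /andP[_ xj].
  have := le_lt_trans ix xj.
  by rewrite ltr_pM2r ?invr_gt0// ltr_nat ltnS.
move=> i j _ _ [x [Iix Ijx]]; apply/val_inj/eqP.
by rewrite eqn_leq !(aux _ _ x).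
Qed.

Lemma cell_sub01 k : I k `<=` `[0, 1[%classic.
Proof.
move=> x /I_cell /=; rewrite !in_itv/= => /andP[xl xr]; apply/andP; split.
  by rewrite (le_trans _ xl)// divr_ge0.
by rewrite (lt_le_trans xr)// ler_pdivrMr// mul1r ler_nat.
Qed.

End cells.

Lemma step_class_subset (R : realType) (nu nu' e L : R) : nu <= nu' ->
  step_class nu' e L `<=` step_class nu e L.
Proof. by move=> nunu' s [H ?]; split => //; exact: le_trans H. Qed.

Section elementary_bounds.
Context (R : realType) d (Omega : measurableType d) (P : probability Omega R).
Variables (n : nat) (eps : 'I_n -> {RV P >-> R}).
Hypothesis Heps : gaussian_noise eps.

Lemma minimax_risk_subset (sigma p : R) (B B' : set (stepFun R)) :
  B `<=` B' -> (minimax_risk eps sigma p B <= minimax_risk eps sigma p B')%E.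
Proof.
move=> BB'; apply: le_ereal_inf_tmp => _ [muhat Hmuhat <-].
apply: ge_ereal_inf; eexists; first by exists muhat.
by apply: ereal_sup_le => _ [s Bs <-]; exists s => //; exact: BB'.
Qed.

(** A single block [0,1) contains all n design points; eta^2 n = sigma^2 then corresponds to K =
    1/4. *)
Lemma minimax_risk_const (sigma p nu e L : R) :
  0 < sigma -> 1 <= p -> (0 < n)%N -> nu <= 1 ->
  ((expR (- 4^-1) / 4 * (sigma / Num.sqrt n%:R))%:E <=
    minimax_risk eps sigma p (step_class nu e L))%E.
Proof.
move=> s0 p1 n0 nu1; have n0' : 0 < n%:R :> R by rewrite ltr0n.
have sn0 : 0 < Num.sqrt n%:R :> R by rewrite sqrtr_gt0.
have := @minimax_risk_ge _ _ _ _ _ _ Heps sigma p 4^-1 (sigma / Num.sqrt n%:R)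
  1 1 (step_class nu e L) (fun=> 0) (fun=> `[0, 1[%classic) s0 p1.
rewrite mul1r powR1 mulr1; apply => //.
- by rewrite ltW// divr_gt0.
- by move=> _ x.
- by move=> i j _ _ _; rewrite (ord1 i) (ord1 j).
- by move=> _; rewrite lebesgue_measure_itv/= lte_fin ltr01 -EFinB subr0.
- move=> _.
  have -> : 4 * sigma ^+ 2 / 4 = (sigma / Num.sqrt n%:R) ^+ 2 * n%:R.
    by rewrite expr_div_n sqr_sqrtr ?ltW// divfK ?gt_eqF//; field.
  rewrite ler_wpM2l ?sqr_ge0//.
  rewrite -[leRHS]mulr1 mulr_natl -[X in _ *+ X](card_ord n) -sumr_const.
  by apply: ler_sum => i _; rewrite indicE; case: (_ \in _).
- move=> t; exists (const_step (sigma / Num.sqrt n%:R * (t ord0)%:R)); split.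
    exact: const_step_class.
  by move=> x; rewrite const_stepE big_ord1 add0r mulrA.
Qed.

(** The change-points stay fixed ([delta] is 0 in the block functions), and [I k] is the upper
    segment of its cell, on which [g] is 1. *)
Lemma minimax_risk_level (m' : nat) (sigma p w h eta K e L : R) :
  0 < sigma -> 1 <= p -> (0 < n)%N -> 0 < w -> 0 < eta -> 1 + eta <= L ->
  e < 1 -> w <= h -> w <= m'.+1%:R^-1 - h ->
  eta ^+ 2 * (n%:R * (m'.+1%:R^-1 - h) + 1) <= 4 * sigma ^+ 2 * K ->
  ((expR (- K) / 4 * (eta * (m'.+1%:R * (m'.+1%:R^-1 - h)) `^ p^-1))%:E <=
    minimax_risk eps sigma p (step_class w e L))%E.
Proof.
move=> s0 p1 n0 w0 eta0 etaL e1 wl wr count.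
have wl' : w <= h - 0 by rewrite subr0.
pose lo (k : 'I_m'.+1) : R := k%:R / m'.+1%:R + h.
have hiE (k : 'I_m'.+1) : k.+1%:R / m'.+1%:R - lo k = m'.+1%:R^-1 - h :> R.
  by rewrite /lo -[k.+1%:R]natr1 mulrDl mul1r; ring.
have len0 : 0 < m'.+1%:R^-1 - h by exact: lt_le_trans wr.
have lohi k : lo k < k.+1%:R / m'.+1%:R by rewrite -subr_gt0 hiE.
pose I k := `[lo k, k.+1%:R / m'.+1%:R[%classic : set R.
have I_cell k : I k `<=` `[k%:R / m'.+1%:R, k.+1%:R / m'.+1%:R[%classic.
  move=> x; rewrite /I /= !in_itv/= => /andP[xl ->]; rewrite andbT.
  by rewrite (le_trans _ xl)// lerDl (le_trans _ wl)// ltW.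
apply: (@minimax_risk_ge _ _ _ _ _ _ Heps _ _ _ _ _ _ _
    (fun x => \sum_k \1_(I k) x) I) => //.
- exact: ltW.
- by move=> k; exact: measurable_itv.
- exact: cell_sub01.
- exact: cell_trivIset.
- by move=> k; rewrite lebesgue_measure_itv/= lte_fin lohi -EFinB hiE.
- move=> k; apply: le_trans count; rewrite ler_wpM2l ?sqr_ge0// -(hiE k).
  by apply: sum_design_itv_le => //; exact: ltW.
move=> t; exists (block_step w0 (lexx (0 : R)) (ltW eta0) wl' wr t); split.
  exact: block_step_class.
move=> x; rewrite block_stepE mulr_sumr -big_split/=; apply: eq_bigr => k _.
by rewrite mulr0 subr0 mulrDl mul1r mulrA.
Qed.

(** Moving a jump from 0 to 1 changes the function by 1 on a strip of length [delta]. The count of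
    design points is a hypothesis because the generic bound n delta + 1 is too large when [sigma] is
    small and K is fixed; a strip free of design points is then used. *)
Lemma minimax_risk_shift (m' : nat) (sigma p w h delta K e L : R) :
  0 < sigma -> 1 <= p -> (0 < n)%N -> 0 < w -> 0 < delta -> 1 <= L ->
  e < 1 -> w <= h - delta -> w <= m'.+1%:R^-1 - h ->
  (forall k : 'I_m'.+1, \sum_(i < n)
     \1_(`[k%:R / m'.+1%:R + (h - delta), k%:R / m'.+1%:R + h[%classic : set R)
        (i%:R / n%:R : R)
     <= 4 * sigma ^+ 2 * K) ->
  ((expR (- K) / 4 * (m'.+1%:R * delta) `^ p^-1)%:E <=
    minimax_risk eps sigma p (step_class w e L))%E.
Proof.
move=> s0 p1 n0 w0 delta0 L1 e1 wl wr count.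
pose I (k : 'I_m'.+1) :=
  `[k%:R / m'.+1%:R + (h - delta), k%:R / m'.+1%:R + h[%classic : set R.
have I_cell k : I k `<=` `[k%:R / m'.+1%:R, k.+1%:R / m'.+1%:R[%classic.
  apply: cell_subset; first by rewrite (le_trans _ wl)// ltW.
  by rewrite -subr_ge0 (le_trans _ wr)// ltW.
rewrite -[_ `^ _]mul1r.
apply: (@minimax_risk_ge _ _ _ _ _ _ Heps _ _ _ _ _ _ _
    (fun x => \sum_(k < m'.+1)
       \1_(`[k%:R / m'.+1%:R + h, k.+1%:R / m'.+1%:R[%classic : set R) x) I) => //.
- by move=> k; exact: measurable_itv.
- exact: cell_sub01.
- exact: cell_trivIset.
- move=> k; rewrite lebesgue_measure_itv/= lte_fin ltrD2l gtrBl delta0 -EFinB.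
  by congr EFin; ring.
- by move=> k; rewrite expr1n mul1r; exact: count.
move=> t; exists (block_step w0 (ltW delta0) (lexx (0 : R)) wl wr t); split.
  by apply: block_step_class; rewrite ?addr0.
move=> x; rewrite block_stepE mul1r -big_split/=; apply: eq_bigr => k _.
rewrite mul0r addr0 mul1r; case: (t k); last by rewrite mul0r subr0 mul0r addr0.
rewrite !mul1r /I.
have hd : h - delta <= h by rewrite gerBl ltW.
have hm : h <= m'.+1%:R^-1 by rewrite -subr_ge0 (le_trans _ wr)// ltW.
rewrite -[k.+1%:R]natr1 mulrDl mul1r !indicE !mem_setE !in_itv/=.
(* In coordinates relative to the cell, [h - delta, 1/m) is split at h. *)
have [y ->] : exists y, x = k%:R / m'.+1%:R + y.
  by exists (x - k%:R / m'.+1%:R); rewrite addrC subrK.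
rewrite !lerD2l !ltrD2l.
have [yh|yh] := leP h y.
  by rewrite (le_trans hd yh) /= addr0.
by rewrite (lt_le_trans yh hm) !andbT /= add0r.
Qed.

End elementary_bounds.

(** * Rates *)

Section rates.
Context (R : realType).

(** For c in (0,1] and an exponent at most 1, c <= c^(1/p). *)
Lemma mul_powR_le (c x p : R) : 0 < c -> c <= 1 -> 0 <= x -> 1 <= p ->
  c * x `^ p^-1 <= (c * x) `^ p^-1.
Proof.
move=> c0 c1 x0 p1; rewrite powRM ?(ltW c0)// ler_wpM2r ?powR_ge0//.
by rewrite ger1_powR ?c0// invf_le1// (lt_le_trans ltr01).
Qed.

Lemma powR_rate_le1D (r p : R) : 0 <= r -> 1 <= p ->
  r `^ (Num.min 2^-1 p^-1) <= 1 + r.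
Proof.
move=> r0 p1; set e := Num.min _ _.
have e0 : 0 <= e by rewrite /e le_min invr_ge0 ler0n invr_ge0 (le_trans ler01).
have e1 : e <= 1 by rewrite /e ge_min invf_le1// ler1n.
have [r1|/ltW r1] := leP 1 r.
  by rewrite (le_trans (ler1_powR r1 e1))// lerDr.
have : r `^ e <= 1 `^ e by rewrite ge0_ler_powR// nnegrE.
by rewrite powR1 => /le_trans; apply; rewrite lerDl.
Qed.

Lemma powR_rate_le_sqrt (r p : R) : 0 < r -> 0 < p -> p <= 2 \/ 1 <= r ->
  r `^ (Num.min 2^-1 p^-1) <= Num.sqrt r.
Proof.
move=> r0 p0; rewrite -powR12_sqrt ?(ltW r0)// => -[p2|r1].
  by have /min_idPl -> : 2^-1 <= p^-1 by rewrite lef_pV2 ?posrE.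
by apply: ler_powR => //; rewrite ge_min lexx.
Qed.

Lemma sqrt_sqr_div (sigma x : R) : 0 <= sigma -> 0 <= x ->
  Num.sqrt (sigma ^+ 2 / x) = sigma / Num.sqrt x.
Proof. by move=> s0 x0; rewrite sqrtrM ?sqr_ge0// sqrtr_sqr ger0_norm// sqrtrV. Qed.

(** Two adjacent intervals of total length less than the grid step 1/n cannot both contain a design
    point. *)
Lemma empty_half (n : nat) (x delta : R) : (0 < n)%N ->
  n%:R * (2 * delta) < 1 ->
  exists2 y, y = x \/ y = x + delta &
    \sum_(i < n) \1_(`[y, y + delta[%classic : set R) (i%:R / n%:R : R) = 0 :> R.
Proof.
move=> n0 small; have n0' : 0 < n%:R :> R by rewrite ltr0n.
pose A y (i : 'I_n) := (i%:R / n%:R : R) \in `[y, y + delta[.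
have empty y : ~~ [exists i, A y i] ->
    \sum_(i < n) \1_(`[y, y + delta[%classic : set R) (i%:R / n%:R : R) = 0 :> R.
  move=> /existsPn Ay; apply: big1 => i _; rewrite indicE mem_setE.
  by have := Ay i; rewrite /A => /negbTE ->.
have [/existsP[i Ai]|A0] := boolP [exists i, A x i]; last first.
  by exists x; [left|exact: empty].
exists (x + delta); [by right|apply: empty].
apply/existsP => -[j Aj].
move: Ai Aj; rewrite /A !in_itv/= => /andP[xi ix] /andP[xj jx].
have ij : (i < j)%N.
  rewrite -(ltr_nat R) -(ltr_pM2r (_ : 0 < n%:R^-1)) ?invr_gt0//.
  exact: lt_le_trans xj.
have : (1 : R) <= j%:R - i%:R by rewrite lerBrDl natr1 ler_nat.
move: xi jx; rewrite ler_pdivlMr// ltr_pdivrMr// => xi jx.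
move: small xi jx; move: (i%:R) (j%:R) (n%:R) => a b c; lra.
Qed.

(** The number of blocks is the integer part of 1/(4w), which is at least 1; the second bound uses m
    + 1 <= 2 m. *)
Lemma block_count (w : R) : 0 < w -> w <= 4^-1 ->
  exists m' : nat, 4 * w * m'.+1%:R <= 1 /\ 1 <= 8 * w * m'.+1%:R.
Proof.
move=> w0 w4; pose x := (4 * w)^-1.
have w40 : 0 < 4 * w by rewrite mulr_gt0.
have x1 : 1 <= x by rewrite invf_ge1//; lra.
have /andP[] := truncn_itv (le_trans ler01 x1).
case E : (Num.truncn x) => [|m'].
  by move=> _ /lt_le_trans/(_ x1); rewrite ltxx.
move=> mx xm; exists m'; split.
  by rewrite mulrC -ler_pdivlMr// mul1r.
move: xm; rewrite /x -[m'.+2%:R]natr1 -[X in X < _]mul1r ltr_pdivrMr//.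
have : (1 : R) <= m'.+1%:R by rewrite ler1n.
by move: m'.+1%:R => z z1 H; nra.
Qed.

End rates.

(** * Fixed smallest segment length *)

Section lower_bounds.
Context (R : realType) d (Omega : measurableType d) (P : probability Omega R).
Variables (n : nat) (eps : 'I_n -> {RV P >-> R}).
Hypothesis Heps : gaussian_noise eps.

Lemma minimax_risk_fixed_nu (nu sigma e L p : R) :
  0 < nu -> nu < 2^-1 -> 0 < sigma -> e < 1 -> 1 < L -> 1 <= p -> (0 < n)%N ->
  ((expR (- 2^-1) / 4 * ((1 - 2 * nu) / 2) *
     (sigma ^+ 2 / n%:R) `^ (Num.min 2^-1 p^-1))%:E
    <= minimax_risk eps sigma p (step_class nu e L))%E.
Proof.
move=> nu0 nu2 s0 e1 L1 p1 n0; have n0' : 0 < n%:R :> R by rewrite ltr0n.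
have p0 : 0 < p by exact: lt_le_trans p1.
set r := sigma ^+ 2 / n%:R.
have nr : n%:R * r = sigma ^+ 2 by rewrite /r mulrC divfK ?gt_eqF.
have r0 : 0 < r by rewrite divr_gt0// exprn_gt0.
pose c := (1 - 2 * nu) / 2.
have c0 : 0 < c by rewrite /c; lra.
have c1 : c <= 1 by rewrite /c; lra.
(* In the first case the rate is at most sqrt r, which the constants attain. Otherwise p > 2 and r <
   1, and a jump is moved. *)
have [case1|/not_orP[/negP + /negP]] := pselect (p <= 2 \/ 1 <= r).
  apply: (le_trans _ (minimax_risk_const Heps e L s0 p1 n0 _)); last by lra.
  rewrite lee_fin -/c -sqrt_sqr_div ?(ltW s0) ?(ltW n0')// -/r.
  apply: ler_pM; rewrite ?powR_ge0//.
  - by rewrite mulr_ge0 ?(ltW c0)// divr_ge0// expR_ge0.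
  - rewrite -[leRHS]mulr1 ler_pM ?(ltW c0)// ?divr_ge0 ?expR_ge0//.
    by rewrite ler_pM2r ?invr_gt0// ler_expR; lra.
  - exact: powR_rate_le_sqrt.
rewrite -!ltNge => p2 r1.
have /min_idPr -> : p^-1 <= 2^-1 by rewrite lef_pV2 ?posrE// ltW.
pose delta := c * r.
have delta0 : 0 < delta by rewrite mulr_gt0.
(* The strip ends at h. Since r < 1, two adjacent strips of length [delta] fit into [nu, 1 - nu];
   the count 2 sigma^2 means K = 1/2. *)
have [h [hl hr count]] : exists h, [/\ nu <= h - delta, nu <= 1 - h &
    \sum_(i < n) \1_(`[h - delta, h[%classic : set R) (i%:R / n%:R : R)
      <= 2 * sigma ^+ 2].
  have d2 : nu + 2 * delta <= 1 - nu.
    by rewrite /delta /c; nra.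
  (* For sigma >= 1 the generic count c sigma^2 + 1 is small enough. For sigma < 1 one has 2 n delta
     < 1, and one of the two strips is empty. *)
  have [s1|s1] := leP 1 sigma.
    exists (nu + delta); split; [by lra|by lra|].
    apply: (le_trans (sum_design_itv_le n0 _)); first by lra.
    have : 1 <= sigma ^+ 2 by rewrite exprn_ege1.
    have -> : n%:R * (nu + delta - (nu + delta - delta)) = c * sigma ^+ 2.
      by rewrite -nr /delta; ring.
    by nra.
  have [] := @empty_half R n nu delta n0.
    have -> : n%:R * (2 * delta) = 2 * c * sigma ^+ 2 by rewrite -nr /delta; ring.
    have : sigma ^+ 2 < 1 by rewrite expr_lt1// ltW.
    have : 0 < sigma ^+ 2 by rewrite exprn_gt0.
    by rewrite /c; nra.
  move=> y yE y0; exists (y + delta).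
  rewrite addrK y0 mulr_ge0 ?sqr_ge0//; split => //.
    by case: yE => ->; lra.
  by case: yE => ->; lra.
apply: (le_trans _ (@minimax_risk_shift _ _ _ _ _ _ Heps 0 sigma p nu h delta
    2^-1 e L s0 p1 n0 nu0 delta0 (ltW L1) e1 hl _ _)).
- rewrite lee_fin mul1r -[leLHS]mulrA ler_wpM2l ?divr_ge0 ?expR_ge0//.
  by rewrite mul_powR_le// ltW.
- by rewrite invr1.
- move=> k; rewrite (ord1 k) /= mul0r !add0r.
  by apply: (le_trans count); lra.
Qed.

End lower_bounds.

(** * Shrinking segment length *)

Section many_blocks.
Context (R : realType) d (Omega : measurableType d) (P : probability Omega R).
Variables (n : nat) (eps : 'I_n -> {RV P >-> R}).
Hypothesis Heps : gaussian_noise eps.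

(** For bounded n the constants give a risk bounded below, while the rate is at most 1 + r <= D. *)
Lemma minimax_risk_few_blocks (b sigma D N nu e L p r : R) :
  0 < sigma -> 1 <= p -> (0 < n)%N -> nu <= 1 -> 0 <= r -> 1 + r <= D ->
  n%:R <= N ->
  ((expR (- 4^-1) / 4 * (sigma / Num.sqrt N) / D *
     r `^ (Num.min 2^-1 p^-1))%:E
    <= minimax_risk eps sigma p (step_class nu e L))%E.
Proof.
move=> s0 p1 n0 nu1 r0 rD nN; have n0' : 0 < n%:R :> R by rewrite ltr0n.
have N0 : 0 < N by exact: lt_le_trans nN.
have D0 : 0 < D by rewrite (lt_le_trans _ rD)// ltr_pwDl.
apply: (le_trans _ (minimax_risk_const Heps e L s0 p1 n0 nu1)).
rewrite lee_fin -[leLHS]mulrA -[leRHS]mulr1; apply: ler_pM.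
- by rewrite mulr_ge0 ?divr_ge0 ?expR_ge0 ?sqrtr_ge0// ltW.
- by rewrite mulr_ge0 ?powR_ge0// invr_ge0 ltW.
- rewrite ler_wpM2l ?divr_ge0 ?expR_ge0// ler_wpM2l ?(ltW s0)//.
  by rewrite lef_pV2 ?posrE ?sqrtr_gt0 ?ler_wsqrtr.
- rewrite ler_pdivrMl// mulr1.
  exact: le_trans (powR_rate_le1D r0 p1) rD.
Qed.

Variables (b sigma D w r : R).
Hypotheses (b0 : 0 < b) (s0 : 0 < sigma) (n0 : (0 < n)%N) (w0 : 0 < w).
Hypotheses (w4 : w <= 4^-1) (bnw : b <= n%:R * w).
Hypotheses (rE : r * (n%:R * w) = sigma ^+ 2) (r0 : 0 < r).
Hypotheses (rD : 1 + r <= D).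

Let D0 : 0 < D.
Proof. by move: r0 rD; lra. Qed.

(** The upper half of each cell is perturbed, so the blocks have total measure 1/2. A block of
    length at most 4 w holds at most 4 n w + 1 design points, whence K. *)
Lemma minimax_risk_many_levels (e L p : R) : e < 1 -> 1 < L -> 1 <= p ->
  ((expR (- ((4 + b^-1) / 4)) / 4 * (Num.min 1 (L - 1) / D * 2^-1) *
     Num.sqrt r)%:E
    <= minimax_risk eps sigma p (step_class w e L))%E.
Proof.
move=> e1 L1 p1; have n0' : 0 < n%:R :> R by rewrite ltr0n.
have [m' [m4 m8]] := block_count w0 w4.
have m0 : 0 < m'.+1%:R :> R by rewrite ltr0n.
set m : R := m'.+1%:R in m4 m8 m0 *.
pose h := m^-1 / 2.
have hE : m^-1 - h = h by rewrite /h; field.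
have mh : m * h = 2^-1 by rewrite /h mulrA mulfV ?mul1r// gt_eqF.
have wh : w <= h.
  by rewrite -(ler_pM2l m0) mh; move: m4; lra.
have hw : h <= 4 * w.
  by rewrite -(ler_pM2l m0) mh; move: m8; lra.
(* As sqrt r <= D, this factor keeps eta <= L - 1, and eta^2 <= r. *)
pose tau := Num.min 1 (L - 1) / D.
have tau0 : 0 < tau by rewrite divr_gt0// lt_min ltr01 subr_gt0.
have sr0 : 0 < Num.sqrt r by rewrite sqrtr_gt0.
have sr1 : Num.sqrt r <= D.
  have := sqr_sqrtr (ltW r0); move: rD sr0; nra.
have tau1 : tau <= 1.
  rewrite ler_pdivrMr// mul1r ge_min; apply/orP; left.
  by move: r0 rD; lra.
have etaL : 1 + tau * Num.sqrt r <= L.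
  rewrite addrC -lerBrDr (le_trans (_ : _ <= tau * D))//.
    by rewrite ler_pM2l.
  by rewrite divfK ?gt_eqF// ge_min lexx orbT.
have eta0 : 0 < tau * Num.sqrt r by rewrite mulr_gt0.
apply: (le_trans _ (@minimax_risk_level _ _ _ _ _ _ Heps m' sigma p w h
  (tau * Num.sqrt r) ((4 + b^-1) / 4) e L s0 p1 n0 w0 eta0 etaL e1 wh _ _)).
- rewrite -/m hE mh lee_fin -[leLHS]mulrA ler_wpM2l ?divr_ge0 ?expR_ge0//.
  rewrite -/tau mulrAC ler_wpM2l ?(ltW eta0)//.
  by rewrite ger1_powR ?invr_gt0 ?ltr0n ?invf_le1 ?ler1n// (lt_le_trans ltr01).
- by rewrite -/m hE.
- rewrite -/m hE exprMn sqr_sqrtr ?(ltW r0)//.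
  have -> : 4 * sigma ^+ 2 * ((4 + b^-1) / 4) = r * (n%:R * w * (4 + b^-1)).
    by rewrite -rE; field; rewrite gt_eqF.
  (* The hypothesis b <= n w absorbs the additive 1 of the count. *)
  have nw1 : 1 <= n%:R * w * b^-1 by rewrite ler_pdivlMr// mul1r.
  have t2 : tau ^+ 2 <= 1 by rewrite expr_le1// ltW.
  have nh : n%:R * h <= n%:R * (4 * w) by rewrite ler_wpM2l// ltW.
  rewrite mulrC; apply: (@le_trans _ _ ((n%:R * h + 1) * r)).
    rewrite ler_wpM2l//.
      by rewrite addr_ge0// mulr_ge0// ?ltW// (lt_le_trans w0).
    by rewrite -[leRHS]mul1r ler_wpM2r// ltW.
  rewrite mulrC ler_wpM2l ?(ltW r0)// mulrDr.
  by move: nw1 nh; rewrite mulrA; lra.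
Qed.

(** With delta = r w / D a strip holds at most sigma^2 / D + 1 design points, delta <= w leaves
    segments of length w, and 8 w m >= 1 gives m delta >= r / (8 D). *)
Lemma minimax_risk_many_shifts (e L p : R) : e < 1 -> 1 < L -> 1 <= p ->
  ((expR (- ((sigma ^+ 2 + 1) / (4 * sigma ^+ 2))) / 4 * (D^-1 / 8) *
     r `^ p^-1)%:E
    <= minimax_risk eps sigma p (step_class w e L))%E.
Proof.
move=> e1 L1 p1; have n0' : 0 < n%:R :> R by rewrite ltr0n.
have [m' [m4 m8]] := block_count w0 w4.
have m0 : 0 < m'.+1%:R :> R by rewrite ltr0n.
set m : R := m'.+1%:R in m4 m8 m0 *.
pose h := m^-1 / 2.
have hE : m^-1 - h = h by rewrite /h; field.
have mh : m * h = 2^-1 by rewrite /h mulrA mulfV ?mul1r// gt_eqF.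
have wh : 2 * w <= h.
  by rewrite -(ler_pM2l m0) mh; move: m4; lra.
have D1 : 1 <= D by move: r0 rD; lra.
have Di0 : 0 < D^-1 by rewrite invr_gt0.
have Di1 : D^-1 <= 1 by rewrite invf_le1.
pose delta := D^-1 * r * w.
have delta0 : 0 < delta by rewrite !mulr_gt0.
have deltaw : delta <= w.
  rewrite -[leRHS]mul1r ler_wpM2r ?(ltW w0)// ler_pdivrMl// mulr1.
  by move: rD; lra.
have s20 : 0 < sigma ^+ 2 by rewrite exprn_gt0.
have wr : w <= m^-1 - h by rewrite hE; move: wh w0; lra.
have wl : w <= h - delta by move: wh deltaw; lra.
apply: (le_trans _ (@minimax_risk_shift _ _ _ _ _ _ Heps m' sigma p w h delta
  ((sigma ^+ 2 + 1) / (4 * sigma ^+ 2)) e L s0 p1 n0 w0 delta0 (ltW L1) e1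
  wl wr _)).
- rewrite lee_fin -[leLHS]mulrA ler_wpM2l ?divr_ge0 ?expR_ge0// -/m.
  apply: (@le_trans _ _ ((D^-1 / 8 * r) `^ p^-1)).
    rewrite mul_powR_le ?(ltW r0) ?divr_gt0//.
    by move: Di1; lra.
  rewrite ge0_ler_powR ?nnegrE ?invr_ge0 ?(le_trans ler01 p1)//.
  + by rewrite !mulr_ge0 ?(ltW Di0) ?(ltW r0).
  + by rewrite mulr_ge0 ?(ltW m0) ?(ltW delta0).
  + have -> : m * delta = D^-1 * r * (8 * w * m) / 8.
      by rewrite /delta; field; rewrite gt_eqF.
    rewrite mulrAC ler_wpM2r ?invr_ge0// -[leLHS]mulr1 ler_wpM2l//.
    by rewrite mulr_ge0 ?(ltW Di0) ?(ltW r0).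
- move=> k; apply: (le_trans (sum_design_itv_le n0 _)).
    by rewrite lerD2l gerBl ltW.
  have -> : n%:R * (k%:R / m + h - (k%:R / m + (h - delta))) = D^-1 * sigma ^+ 2.
    by rewrite -rE /delta; ring.
  have -> : 4 * sigma ^+ 2 * ((sigma ^+ 2 + 1) / (4 * sigma ^+ 2)) = sigma ^+ 2 + 1.
    by field; rewrite gt_eqF.
  by rewrite lerD2r ler_piMl// ltW.
Qed.

End many_blocks.

Lemma shrinking_segments_rate (R : realType) (b gamma : R) (n : nat) :
  0 < b -> 0 < gamma -> gamma < 1 -> (0 < n)%N ->
  let w := b * n%:R `^ (- gamma) in
  [/\ 0 < w, b <= n%:R * w, b * n%:R `^ (1 - gamma) = n%:R * w &
      4^-1 < w -> n%:R <= (4 * b) `^ gamma^-1].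
Proof.
move=> b0 g0 g1 n0 w; have n0' : 0 < n%:R :> R by rewrite ltr0n.
have wE : b * n%:R `^ (1 - gamma) = n%:R * w.
  by rewrite powRD ?(gt_eqF n0') ?implybT// powRr1 ?ltW// /w; ring.
split => //.
- by rewrite mulr_gt0// powR_gt0.
- rewrite -wE -[leLHS]mulr1 ler_wpM2l ?(ltW b0)//.
  have : n%:R `^ 0 <= n%:R `^ (1 - gamma) :> R.
    by apply: ler_powR; rewrite ?ler1n// subr_ge0 ltW.
  by rewrite powRr0.
rewrite /w powRN => H.
have ng : n%:R `^ gamma <= 4 * b.
  move: H; rewrite ltr_pdivlMr ?powR_gt0//; lra.
have nE : n%:R = (n%:R `^ gamma) `^ gamma^-1 :> R.
  by rewrite -powRrM mulfV ?gt_eqF// powRr1// ltW.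
rewrite nE ge0_ler_powR ?nnegrE ?powR_ge0// ?invr_ge0 ?ltW//.
exact: mulr_gt0.
Qed.

Theorem theorem3p4 (R : realType) :
  (forall nu : R, 0 < nu -> nu < 2^-1 ->
   exists2 C : R, 0 < C &
   forall (sigma epsilon L p : R),
     0 < sigma -> 0 < epsilon -> epsilon < 1 -> 1 < L -> 1 <= p ->
   forall (n : nat) (d : measure_display) (Omega : measurableType d)
     (P : probability Omega R) (eps : 'I_n -> {RV P >-> R}),
     (0 < n)%N -> gaussian_noise eps ->
     ((C * (sigma ^+ 2 / n%:R) `^ (Num.min 2^-1 p^-1))%:E
        <= minimax_risk eps sigma p (step_class nu epsilon L))%E)
  /\
  (forall b sigma gamma epsilon L : R,
     0 < b -> 0 < sigma -> 0 < gamma -> gamma < 1 ->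
     0 < epsilon -> epsilon < 1 -> 1 < L ->
   exists2 C : R, 0 < C &
   forall (a p : R), 0 < a -> 1 <= p ->
   forall (nu : nat -> R) (n : nat) (d : measure_display)
     (Omega : measurableType d) (P : probability Omega R)
     (eps : 'I_n -> {RV P >-> R}),
     (0 < n)%N -> gaussian_noise eps ->
     0 < nu n -> nu n < 2^-1 ->
     a * n%:R `^ (- gamma) <= nu n -> nu n <= b * n%:R `^ (- gamma) ->
     ((C * (sigma ^+ 2 / (b * n%:R `^ (1 - gamma)))
             `^ (Num.min 2^-1 p^-1))%:E
        <= minimax_risk eps sigma p (step_class (nu n) epsilon L))%E).
Proof.
split.
  move=> nu nu0 nu2; exists (expR (- 2^-1) / 4 * ((1 - 2 * nu) / 2)).
    by rewrite mulr_gt0 ?divr_gt0 ?expR_gt0//; lra.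
  move=> sigma e L p s0 _ e1 L1 p1 n d Omega P eps n0 Heps.
  exact: minimax_risk_fixed_nu.
move=> b sigma gamma e L b0 s0 g0 g1 _ e1 L1.
have s20 : 0 < sigma ^+ 2 by rewrite exprn_gt0.
(* An upper bound of 1 + r for every n, because n w >= b. *)
pose D := 1 + sigma ^+ 2 / b.
have D0 : 0 < D by rewrite ltr_pwDl// divr_ge0// ltW.
(* One constant per regime: w > 1/4, then p <= 2, then p > 2. None depends on a, p or n. *)
pose C1 := expR (- 4^-1) / 4 * (sigma / Num.sqrt ((4 * b) `^ gamma^-1)) / D.
pose C2 := expR (- ((4 + b^-1) / 4)) / 4 * (Num.min 1 (L - 1) / D * 2^-1).
pose C3 := expR (- ((sigma ^+ 2 + 1) / (4 * sigma ^+ 2))) / 4 * (D^-1 / 8).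
have C10 : 0 < C1.
  apply: divr_gt0 => //; apply: mulr_gt0; apply: divr_gt0 => //.
  by rewrite sqrtr_gt0 powR_gt0// mulr_gt0.
have C20 : 0 < C2.
  by rewrite !mulr_gt0 ?invr_gt0 ?expR_gt0// lt_min ltr01 subr_gt0.
have C30 : 0 < C3 by rewrite !mulr_gt0 ?invr_gt0 ?expR_gt0.
exists (Num.min C1 (Num.min C2 C3)); first by rewrite !lt_min C10 C20.
move=> a p _ p1 nu n d Omega P eps n0 Heps nu0 nu2 _ nuw.
have [w0 bnw wE wN] := shrinking_segments_rate b0 g0 g1 n0.
set w := b * n%:R `^ (- gamma) in nuw w0 bnw wE wN.
rewrite wE; set r := sigma ^+ 2 / (n%:R * w).
have nw0 : 0 < n%:R * w by exact: lt_le_trans bnw.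
have r0 : 0 < r by rewrite divr_gt0.
have rE : r * (n%:R * w) = sigma ^+ 2 by rewrite divfK ?gt_eqF.
have rD : 1 + r <= D.
  by rewrite lerD2l ler_pM2l// lef_pV2.
have reduce Ci q : Num.min C1 (Num.min C2 C3) <= Ci -> 0 <= q ->
    ((Num.min C1 (Num.min C2 C3) * q)%:E <= (Ci * q)%:E)%E.
  by move=> CCi q0; rewrite lee_fin ler_wpM2r.
have [w4|w4] := leP w 4^-1; last first.
  apply: (le_trans (reduce C1 _ _ (powR_ge0 _ _))); first by rewrite ge_min lexx.
  apply: minimax_risk_few_blocks => //; [lra|exact: ltW|exact: wN].
(* As nu n <= w, the class for [w] is the smaller one, and its minimax risk is a lower bound. *)
apply: (le_trans _ (minimax_risk_subset eps sigma p
  (step_class_subset (e := e) (L := L) nuw))).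
have p0 : 0 < p by exact: lt_le_trans p1.
have [p2|p2] := leP p 2.
  apply: (le_trans (reduce C2 _ _ (powR_ge0 _ _))).
    by rewrite !ge_min lexx orbT.
  apply: le_trans
    (minimax_risk_many_levels Heps b0 s0 n0 w0 w4 bnw rE r0 rD e1 L1 p1).
  by rewrite lee_fin ler_wpM2l ?(ltW C20)// powR_rate_le_sqrt//; left.
apply: (le_trans (reduce C3 _ _ (powR_ge0 _ _))).
  by rewrite !ge_min lexx !orbT.
have /min_idPr -> : p^-1 <= 2^-1 by rewrite lef_pV2 ?posrE// ltW.
exact: minimax_risk_many_shifts.
Qed.
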